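(* Let $\Omega$ be a set, $\mathscr{A}\subset 2^{\Omega}$ an algebra, $\mu\in ba(\mathscr{A})$, $\mathscr{L}$ a vector sublattice of $L(\mu)$ with $1\in\mathscr{L}$, and $\phi$ a positive linear functional on $\mathscr{L}$. Denote by $\mathscr{L}^*$ the set of all limit points of sequences from $\mathscr{L}$ which converge orderly in $L(\mu)$. The following are equivalent. (i) $\phi$ extends to a monotone function $\phi^*:\mathscr{L}^*\rightarrow\mathbb{R}$. (ii) $\lim_n\phi(h_n)=0$ whenever $\langle h_n\rangle_{n\in\mathbb{N}}$ is a sequence in $\mathscr{L}$ which converges to $0$ orderly in $L(\mu)$. (iii) $-\infty<\lim_n\phi(g_n)\leq\lim_n\phi(f_n)<\infty$ (in particular, these limits exist) whenever $\langle f_n\rangle_{n\in\mathbb{N}}$ and $\langle g_n\rangle_{n\in\mathbb{N}}$ are sequences in $\mathscr{L}$ which converge orderly in $L(\mu)$ to $f$ and $g$ respectively, with $f\geq g$. (iv) $\phi$ admits a positive representing measure $m$ such that $m^*(h)\equiv\lim_n m(h_n)$ exists in $\mathbb{R}$ and is unique (i.e. depends only on $h$) for every sequence $\langle h_n\rangle_{n\in\mathbb{N}}$ in $\mathscr{L}$ which converges to $h$ orderly in $L(\mu)$. Moreover, if $\phi$ is a positive linear functional on a vector sublattice $\mathscr{L}$ of $\mathbb{R}^{\Omega}$ with $1\in\mathscr{L}$, then there exists a unique positive linear functional $\phi^{\perp}$ on $\mathscr{L}$ such that $\phi^{\perp}(1)=0$ and $$\phi(f)=\phi(1)m(f)+\phi^{\perp}(f)\qquad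 f\in\mathscr{L}$$ for some $m\in ba_+$ satisfying $\mathscr{L}\subset L(m)$.
   Context: Spaces of real-valued functions on $\Omega$ carry the pointwise order; constants are identified with constant functions. For an algebra $\mathscr{A}\subset 2^\Omega$, $ba(\mathscr{A})$ is the space of bounded finitely additive (signed) real set functions on $\mathscr{A}$; $ba=ba(2^\Omega)$ and $ba_+$ is its set of nonnegative elements. For $\mu\in ba(\mathscr{A})$, $L(\mu)$ is the space of real-valued functions $f$ on $\Omega$ integrable with respect to $\mu$ in the finitely additive (Dunford–Schwartz) sense: there are $\mathscr{A}$-simple functions $s_n$ converging to $f$ in $|\mu|$-measure (using the outer set function $|\mu|^*(E)=\inf\{|\mu|(A):A\in\mathscr{A},E\subset A\}$) with $\int|s_n-s_k|\,d|\mu|\to0$ as $n,k\to\infty$; $\mu(f)=\lim_n\int s_n\,d\mu$ is the integral, and $L(\mu)$ has the (semi)norm $\|f\|=\int|f|\,d|\mu|$. When $m\in ba_+$ and $f\geq 0$, $f\in L(m)$ iff $\sup\{m(h):h\text{ bounded},0\leq h\leq f\}<\infty$, and then $m(f)$ equals this supremum. Order convergence: a sequence $\langle f_n\rangle$ converges orderly in $L(\mu)$ to $f\in\mathbb{R}^\Omega$ if $f_n\in L(\mu)$ for all $n$ and there is a pointwise decreasing sequence $\langle\bar f_n\rangle$ of nonnegative elements of $L(\mu)$ which converges to $0$ in the norm of $L(\mu)$ and satisfies $|f_n-f|\leq\bar f_n$ for all $n\geq1$. Representing measure: for a linear functional $\phi$ on a linear subspace $\mathscr{L}\subset\mathbb{R}^\Omega$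 with $1\in\mathscr{L}$, a representing measure for $\phi$ is an $m\in ba$ such that $\mathscr{L}\subset L(m)$ and $\phi(f)=\phi(1)m(f)$ for all $f\in\mathscr{L}$; it is positive if $m\in ba_+$.
   Formalization: In (i), φ* is monotone for the order ''f ≤ g outside a |μ|*-null set'' instead of the pointwise order; with the pointwise order (i)⇒(ii) is false, e.g. Ω a point, μ = 0, 𝓛 = ℝ^Ω, φ(f) = f(pt). *)

(* Defs.v *)
(* MathComp-Analysis: real numbers are an arbitrary [R : realType]. *)
From HB Require Import structures.
From mathcomp Require Import all_boot all_order all_algebra.
From mathcomp Require Import all_classical all_reals all_analysis.

Set Implicit Arguments.
Unset Strict Implicit.
Unset Printing Implicit Defensive.

Import Order.TTheory GRing.Theory Num.Theory.
Import numFieldNormedType.Exports.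

Local Open Scope classical_set_scope.
Local Open Scope ring_scope.

Definition set_algebra (Omega : Type) (A : set (set Omega)) : Prop :=
  setring A /\ A setT.

(* A set function on the algebra [A] is represented by a function on all subsets
   of [Omega] of which only the values on [A] are ever used; [ba setT] is the
   space ba of the text. *)
Definition ba (R : realType) (Omega : Type) (A : set (set Omega))
    (mu : set Omega -> R) : Prop :=
  (forall B C, A B -> A C -> B `&` C = set0 -> mu (B `|` C) = mu B + mu C) /\
  (exists M : R, forall B, A B -> `|mu B| <= M).

Definition ba_pos (R : realType) (Omega : Type) (A : set (set Omega))
    (mu : set Omega -> R) : Prop :=
  ba A mu /\ forall B, A B -> 0 <= mu B.

(* The total variation |mu|: the supremum of the sums of |mu B_i| over the
   finite families of pairwise disjoint elements B_i of [A] contained in [E]. *)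
Definition variation_fa (R : realType) (Omega : Type) (A : set (set Omega))
    (mu : set Omega -> R) (E : set Omega) : R :=
  sup [set r : R | exists (n : nat) (B : nat -> set Omega),
    [/\ forall i, (i < n)%N -> A (B i) /\ B i `<=` E,
        trivIset `I_n B & r = \sum_(i < n) `|mu (B i)|]].

(* The outer set function |mu|^*. *)
Definition outer_variation (R : realType) (Omega : Type) (A : set (set Omega))
    (mu : set Omega -> R) (E : set Omega) : R :=
  inf [set variation_fa A mu B | B in [set B | A B /\ E `<=` B]].

Definition simple_fun (R : realType) (Omega : Type) (A : set (set Omega))
    (s : Omega -> R) : Prop :=
  finite_set (range s) /\ forall c : R, A (s @^-1` [set c]).

Definition simple_integral (R : realType) (Omega : Type) (mu : set Omega -> R)
    (s : Omega -> R) : R :=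
  \sum_(c \in range s) c * mu (s @^-1` [set c]).

Definition cvg_in_variation (R : realType) (Omega : Type)
    (A : set (set Omega)) (mu : set Omega -> R)
    (s : nat -> Omega -> R) (f : Omega -> R) : Prop :=
  forall e : R, 0 < e ->
    outer_variation A mu [set x | e < `|s n x - f x|] @[n --> \oo] --> (0 : R).

Definition determining (R : realType) (Omega : Type) (A : set (set Omega))
    (mu : set Omega -> R) (f : Omega -> R) (s : nat -> Omega -> R) : Prop :=
  [/\ forall n, simple_fun A (s n),
      cvg_in_variation A mu s f &
      forall e : R, 0 < e -> exists N, forall n k, (N <= n)%N -> (N <= k)%N ->
        simple_integral (variation_fa A mu) (fun x => `|s n x - s k x|) < e].

Definition integrable_fa (R : realType) (Omega : Type) (A : set (set Omega))
    (mu : set Omega -> R) : set (Omega -> R) :=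
  [set f | exists s, determining A mu f s].

(* The common limit of the integrals of determining sequences; it is 0 by
   convention if [f] is not integrable. *)
Definition integral_fa (R : realType) (Omega : Type) (A : set (set Omega))
    (mu : set Omega -> R) (f : Omega -> R) : R :=
  xget 0 [set I : R | exists2 s, determining A mu f s &
    simple_integral mu (s n) @[n --> \oo] --> I].

Definition norm_fa (R : realType) (Omega : Type) (A : set (set Omega))
    (mu : set Omega -> R) (f : Omega -> R) : R :=
  integral_fa A (variation_fa A mu) (fun x => `|f x|).

Definition cvg_orderly (R : realType) (Omega : Type) (A : set (set Omega))
    (mu : set Omega -> R) (f_ : nat -> Omega -> R) (f : Omega -> R) : Prop :=
  (forall n, integrable_fa A mu (f_ n)) /\
  exists fbar : nat -> Omega -> R,
    [/\ forall n, integrable_fa A mu (fbar n) /\ forall x, 0 <= fbar n x,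
        forall n x, fbar n.+1 x <= fbar n x,
        norm_fa A mu (fbar n) @[n --> \oo] --> (0 : R) &
        forall n x, `|f_ n x - f x| <= fbar n x].

(* The set L^* of order limits of sequences from [L]. *)
Definition order_limits (R : realType) (Omega : Type) (A : set (set Omega))
    (mu : set Omega -> R) (L : set (Omega -> R)) : set (Omega -> R) :=
  [set f | exists2 f_ : nat -> Omega -> R,
    forall n, L (f_ n) & cvg_orderly A mu f_ f].

(* The order of L(mu): [f <= g] outside a |mu|^*-null set.  It extends the
   pointwise order; with the pointwise order itself the monotone extendability
   of a functional would say nothing about its values on null functions: for
   mu = 0 on a one-point space and L the constants, the identity functional is
   monotone on L^* = L, although the constant sequence 1 converges orderly
   to 0. *)
Definition ae_le (R : realType) (Omega : Type) (A : set (set Omega))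
    (mu : set Omega -> R) (f g : Omega -> R) : Prop :=
  outer_variation A mu [set x | g x < f x] = 0.

Definition vector_sublattice (R : realType) (Omega : Type)
    (L : set (Omega -> R)) : Prop :=
  [/\ L (cst 0),
      forall (a : R) f g, L f -> L g -> L (fun x => a * f x + g x),
      forall f g, L f -> L g -> L (fun x => Num.max (f x) (g x)) &
      forall f g, L f -> L g -> L (fun x => Num.min (f x) (g x))].

(* A functional on [L] is a total function of which only the values on [L]
   matter. *)
Definition positive_linear (R : realType) (Omega : Type)
    (L : set (Omega -> R)) (phi : (Omega -> R) -> R) : Prop :=
  (forall (a : R) f g, L f -> L g ->
     phi (fun x => a * f x + g x) = a * phi f + phi g) /\
  (forall f, L f -> (forall x, 0 <= f x) -> 0 <= phi f).

Definition representing (R : realType) (Omega : Type) (L : set (Omega -> R))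
    (phi : (Omega -> R) -> R) (m : set Omega -> R) : Prop :=
  [/\ ba setT m, L `<=` integrable_fa setT m &
      forall f, L f -> phi f = phi (cst 1) * integral_fa setT m f].

Definition singular_part (R : realType) (Omega : Type) (L : set (Omega -> R))
    (phi psi : (Omega -> R) -> R) : Prop :=
  [/\ positive_linear L psi, psi (cst 1) = 0 &
      exists m : set Omega -> R,
        [/\ ba_pos setT m, L `<=` integrable_fa setT m &
            forall f, L f ->
              phi f = phi (cst 1) * integral_fa setT m f + psi f]].

(* Main.v *)
Require Import Defs.
From HB Require Import structures.
From mathcomp Require Import all_boot all_order all_algebra.
From mathcomp Require Import all_classical all_reals all_analysis.
From mathcomp Require Import ring lra.

Set Implicit Arguments.
Unset Strict Implicit.
Unset Printing Implicit Defensive.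

Import Order.TTheory GRing.Theory Num.Theory.
Import numFieldNormedType.Exports.

Local Open Scope classical_set_scope.
Local Open Scope ring_scope.

(* The Dunford-Schwartz integral of a nonnegative charge is a positive linear
   functional on a lattice, closed under limits in measure that are Cauchy in
   mean; everything is applied to the charge |mu|.

   (i) => (ii).  If phi(h_n) does not tend to 0, the maxima of finitely many of
   the |h_j|, chosen nearly optimal for phi, have running minima w_n in L that
   decrease, have norms tending to 0 (along a subsequence, below 8^-n), and keep
   phi((w_n - c)^+) bounded away from 0.  The sums of 2^n (w_n - c)^+, corrected
   at step K by a large multiple of (w_K - c/2)^+ so as to stay bounded at every
   point, converge orderly to a function f that dominates every 2^n (w_n - c)^+
   almost everywhere; then phi^*(f) would be infinite.

   (iii) => (iv).  The Hahn-Banach theorem extends phi to a positive functional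
   q on the functions dominated by L, and m(E) = q(1_E) / phi(1) represents phi
   on bounded functions.  Since (f - n)^+ converges orderly to 0, order
   continuity extends this to all of L; without it, the defect
   phi(f) - phi(1) m(f) is the functional phi^perp, determined for f >= 0 by
   phi^perp(f) = phi(f) - lim_n phi(min(f, n)). *)

(** The functions that dominate |h_n| need not lie in L, so phi cannot be evaluated on them; a
    decreasing sequence below them has to be built inside L. Near-optimal maxima exist because phi
    is bounded on all finite maxima: their supremum is an order limit from L, where phi^* is finite.
    Thus (i) is used twice, for this bound and for the final blow-up.

    Since mu is only finitely additive, decreasing functions whose norms tend to 0 may all stay
    above c on a nonempty null set, where the series of 2^n (w_n - c)^+ diverges. Order convergence
    asks for real values and a finite dominating function at every point, hence the correction. The
    limit f is set to 0 on a null set, so it dominates only modulo null sets, and phi^* has to be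
    monotone for that order. Cutting at c makes the series a finite sum off the null set and costs
    at most c phi(1). The weight 2^n and the correction together grow at most like 4^n; against
    norms below 8^-n this leaves a geometric series. *)

(** * Limits of real sequences in epsilon form *)

Section cvg_epsilon.
Variable R : realType.
Implicit Types (u : nat -> R) (l : R).

Lemma cvg_seqP u l : u n @[n --> \oo] --> l <->
  forall e : R, 0 < e -> exists N, forall n, (N <= n)%N -> `|u n - l| < e.
Proof.
split=> [/cvgrPdist_lt ul e /ul [N _ ulN]|ul].
  by exists N => n Nn; rewrite distrC; exact: ulN.
apply/cvgrPdist_lt => e /ul [N ulN].
by exists N => // n Nn; rewrite distrC; exact: ulN.
Qed.

Lemma cvg_seq0P u : (forall n, 0 <= u n) -> u n @[n --> \oo] --> (0 : R) <->
  forall e : R, 0 < e -> exists N, forall n, (N <= n)%N -> u n < e.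
Proof.
move=> u0; split=> [/cvg_seqP uc e /uc [N uN]|uc].
  by exists N => n /uN; rewrite subr0 ger0_norm.
apply/cvg_seqP => e /uc [N uN].
by exists N => n /uN; rewrite subr0 ger0_norm.
Qed.

Lemma cauchy_seq_cvg u :
  (forall e : R, 0 < e -> exists N, forall n k, (N <= n)%N -> (N <= k)%N ->
    `|u n - u k| < e) ->
  exists l, u n @[n --> \oo] --> l.
Proof.
move=> uc; exists (lim (u n @[n --> \oo])).
apply/cauchy_cvgP/cauchy_exP => e /uc [N uN].
by exists (u N), N => // n Nn; rewrite /ball/=; exact: uN.
Qed.

End cvg_epsilon.

(** * Integration with respect to a nonnegative charge *)

Section simple_functions.
Variables (R : realType) (Omega : Type) (A : set (set Omega)).
Hypothesis hA : set_algebra A.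

Lemma algebraT : A setT. Proof. by case: hA. Qed.

Lemma algebra0 : A set0. Proof. by case: hA => -[]. Qed.

Lemma algebraU B C : A B -> A C -> A (B `|` C).
Proof. by case: hA => -[_ + _] _; exact. Qed.

Lemma algebraD B C : A B -> A C -> A (B `\` C).
Proof. by case: hA => -[_ _ +] _; exact. Qed.

Lemma algebraI B C : A B -> A C -> A (B `&` C).
Proof. by move=> AB AC; rewrite -setDD; do !apply: algebraD. Qed.

Lemma algebra_fibers (T : eqType) (t : Omega -> T) (r : seq T) :
  (forall d, A (t @^-1` [set d])) -> A [set x | t x \in r].
Proof.
move=> At; elim: r => [|d r IH].
  by rewrite (_ : [set x | _] = set0) ?predeqE//; exact: algebra0.
rewrite (_ : [set x | _] = t @^-1` [set d] `|` [set x | t x \in r]).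
  exact: algebraU.
apply/predeqP => x /=; rewrite inE; split; first by case/orP=> [/eqP|]; [left|right].
by case=> [->|->]; rewrite ?eqxx ?orbT.
Qed.

Section additive.
Variable nu : set Omega -> R.
Hypothesis nuU : forall B C, A B -> A C -> B `&` C = set0 ->
  nu (B `|` C) = nu B + nu C.

Lemma additive0 : nu set0 = 0.
Proof.
have := nuU algebra0 algebra0; rewrite setI0 setU0 => /(_ erefl) e.
by apply: (@addIr _ (nu set0)); rewrite -e add0r.
Qed.

Lemma additive_fibers (T : eqType) (t : Omega -> T) (r : seq T) E :
  uniq r -> A E -> (forall d, A (t @^-1` [set d])) ->
  nu (E `&` [set x | t x \in r]) = \sum_(d <- r) nu (E `&` t @^-1` [set d]).
Proof.
move=> + AE At; elim: r => [_|d r IH /= /andP[dr ur]].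
  by rewrite big_nil (_ : [set x | _] = set0) ?setI0 ?additive0// predeqE.
rewrite big_cons -IH// -nuU.
- congr nu; apply/predeqP => x /=; rewrite inE; split.
    by case=> Ex /orP[/eqP|]; [left|right].
  by case=> -[Ex]; [move=> ->; rewrite eqxx|move=> ->; rewrite orbT].
- by apply: algebraI.
- by apply: algebraI => //; exact: algebra_fibers.
- rewrite predeqE => x; split=> // -[[_ /= ->] [_]].
  by rewrite (negbTE dr).
Qed.

(** Listed values outside the range contribute c * nu(empty set) = 0, so any duplicate-free list
    covering the range will do. *)
Lemma simple_integralE (s : Omega -> R) (r : seq R) : uniq r ->
  (forall x, s x \in r) ->
  simple_integral nu s = \sum_(c <- r) c * nu (s @^-1` [set c]).
Proof.
move=> ur sr; rewrite /simple_integral; apply: fsbig_fwiden => //.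
  by move=> _ [x _ <-]; exact: sr.
move=> c [_ /= rs]; rewrite (_ : s @^-1` _ = set0) ?additive0 ?mulr0//.
by rewrite predeqE => x; split=> // sx; apply: rs; exists x.
Qed.

Lemma simple_fun_comp (T : eqType) (t : Omega -> T) (g : T -> R) (r : seq T) :
  (forall x, t x \in r) -> (forall d, A (t @^-1` [set d])) ->
  simple_fun A (g \o t).
Proof.
move=> tr At; split.
  apply: (@sub_finite_set _ _ [set` map g r]); last exact: finite_seq.
  by move=> _ [x _ <-] /=; apply/map_f/tr.
move=> c; rewrite (_ : _ @^-1` _ = [set x | t x \in [seq d <- r | g d == c]]).
  exact: algebra_fibers.
apply/predeqP => x /=; rewrite mem_filter tr andbT; split=> [->//|].
by move/eqP.
Qed.

(** Integrating over the fibres of one map t puts several simple functions on a common partition: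
    with t x = (s1 x, s2 x), linearity and monotonicity become termwise statements. *)
Lemma simple_integral_comp (T : eqType) (t : Omega -> T) (g : T -> R)
    (r : seq T) :
  uniq r -> (forall x, t x \in r) -> (forall d, A (t @^-1` [set d])) ->
  simple_integral nu (g \o t) = \sum_(d <- r) g d * nu (t @^-1` [set d]).
Proof.
move=> ur tr At; rewrite (@simple_integralE _ (undup (map g r))) ?undup_uniq//;
  last by move=> x; rewrite mem_undup; apply/map_f/tr.
under eq_bigr => c _.
  rewrite (_ : nu _ = \sum_(d <- r) if g d == c then nu (t @^-1` [set d]) else 0).
    rewrite mulr_sumr; over.
  rewrite -[_ @^-1` _]setIT.
  rewrite (_ : setT = [set x | t x \in r]); last first.
    by rewrite predeqE => x; split=> // _; exact: tr.
  rewrite additive_fibers//; last first.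
    by case: (@simple_fun_comp _ t g r tr At) => _; exact.
  apply: eq_bigr => d _; case: eqP => gd.
    congr nu; apply/predeqP => x /=; split=> [[]//|tx].
    by split=> //; rewrite tx.
  rewrite -additive0; congr nu; rewrite predeqE => x; split=> // -[/= + td].
  by rewrite td.
rewrite exchange_big/= !big_seq; apply: eq_bigr => d dr.
rewrite (bigD1_seq (g d)) ?undup_uniq ?mem_undup ?map_f//= eqxx.
by rewrite big1 ?addr0// => c; rewrite eq_sym => /negbTE ->; rewrite mulr0.
Qed.

End additive.
End simple_functions.

(** * Simple integrals with respect to a nonnegative charge *)

Section finite_additivity.
Variables (R : realType) (Omega : Type) (A : set (set Omega)).
Variable nu : set Omega -> R.
Hypotheses (hA : set_algebra A) (nuP : ba_pos A nu).

Lemma ba_posU B C : A B -> A C -> B `&` C = set0 -> nu (B `|` C) = nu B + nu C.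
Proof. by case: nuP => -[+ _] _; exact. Qed.

Lemma ba_pos_ge0 B : A B -> 0 <= nu B.
Proof. by case: nuP => _; exact. Qed.

Lemma ba_pos0 : nu set0 = 0.
Proof. exact: (additive0 hA ba_posU). Qed.

Lemma ba_pos_le B C : A B -> A C -> B `<=` C -> nu B <= nu C.
Proof.
move=> AB AC BC; rewrite -(setDUK BC).
rewrite ba_posU ?lerDl ?ba_pos_ge0//; try exact: algebraD.
by rewrite predeqE => x; split=> // -[? []].
Qed.

Lemma ba_pos_setU B C : A B -> A C -> nu (B `|` C) <= nu B + nu C.
Proof.
move=> AB AC; rewrite -(setDUK (@subsetUl _ B C)) ba_posU//.
- rewrite lerD2l ba_pos_le//; first by apply: algebraD => //; exact: algebraU.
  by move=> x [[]].
- by apply: algebraD => //; exact: algebraU.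
- by rewrite predeqE => x; split=> // -[? []].
Qed.

Lemma simple_pair (s1 s2 : Omega -> R) : simple_fun A s1 -> simple_fun A s2 ->
  exists r : seq (R * R), [/\ uniq r, forall x, (s1 x, s2 x) \in r &
    forall d, A ((fun x => (s1 x, s2 x)) @^-1` [set d])].
Proof.
move=> [/finite_seqP[r1 r1E] A1] [/finite_seqP[r2 r2E] A2].
exists (undup [seq (c, d) | c <- r1, d <- r2]); split.
- exact: undup_uniq.
- move=> x; rewrite mem_undup; apply: allpairs_f.
    by have : range s1 (s1 x) by []; rewrite r1E.
  by have : range s2 (s2 x) by []; rewrite r2E.
- case=> c d; rewrite (_ : _ @^-1` _ = s1 @^-1` [set c] `&` s2 @^-1` [set d]).
    exact: algebraI.
  by apply/predeqP => x /=; split=> [[]|[-> ->]].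
Qed.

Lemma simple_fun2 (g : R -> R -> R) (s1 s2 : Omega -> R) :
  simple_fun A s1 -> simple_fun A s2 -> simple_fun A (fun x => g (s1 x) (s2 x)).
Proof.
move=> S1 S2; have [r [ur sr Ar]] := simple_pair S1 S2.
exact: (simple_fun_comp hA (fun d => g d.1 d.2) sr Ar).
Qed.

Lemma simple_fun1 (g : R -> R) (s : Omega -> R) :
  simple_fun A s -> simple_fun A (fun x => g (s x)).
Proof. by move=> S; exact: (simple_fun2 (fun c _ => g c) S S). Qed.

Lemma preimage_tt (d : unit) : (fun=> tt) @^-1` [set d] = setT :> set Omega.
Proof. by case: d; rewrite predeqE. Qed.

Lemma simple_fun_cst (c : R) : simple_fun A (fun=> c).
Proof.
apply: (simple_fun_comp hA (t := fun=> tt) (fun=> c) (r := [:: tt])) => // d.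
by rewrite preimage_tt; exact: algebraT.
Qed.

Lemma simple_integral_cst (c : R) : simple_integral nu (fun=> c) = c * nu setT.
Proof.
rewrite (simple_integral_comp hA ba_posU (t := fun=> tt) (fun=> c)
  (r := [:: tt]))//; last by move=> d; rewrite preimage_tt; exact: algebraT.
by rewrite big_seq1 preimage_tt.
Qed.

Lemma simple_integral_lin (a : R) (s1 s2 : Omega -> R) :
  simple_fun A s1 -> simple_fun A s2 ->
  simple_integral nu (fun x => a * s1 x + s2 x) =
    a * simple_integral nu s1 + simple_integral nu s2.
Proof.
move=> S1 S2; have [r [ur sr Ar]] := simple_pair S1 S2.
pose I g := simple_integral_comp hA ba_posU g ur sr Ar.
rewrite (I (fun d => a * d.1 + d.2)) (I (fun d => d.1)) (I (fun d => d.2)).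
by rewrite mulr_sumr -big_split/=; apply: eq_bigr => d _; rewrite mulrDl mulrA.
Qed.

Lemma simple_integral_le (s1 s2 : Omega -> R) :
  simple_fun A s1 -> simple_fun A s2 -> (forall x, s1 x <= s2 x) ->
  simple_integral nu s1 <= simple_integral nu s2.
Proof.
move=> S1 S2 s12; have [r [ur sr Ar]] := simple_pair S1 S2.
pose I g := simple_integral_comp hA ba_posU g ur sr Ar.
rewrite (I (fun d => d.1)) (I (fun d => d.2)).
apply: ler_sum => d _.
have [e|/set0P[x /= <-]] :=
  eqVneq ((fun x => (s1 x, s2 x)) @^-1` [set d]) set0.
  by rewrite e ba_pos0 !mulr0.
by apply: ler_wpM2r; [exact/ba_pos_ge0/Ar|exact: s12].
Qed.

Lemma simple_level (b : pred R) (s : Omega -> R) : simple_fun A s ->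
  A [set x | b (s x)] /\
  simple_integral nu (fun x => (b (s x))%:R) = nu [set x | b (s x)].
Proof.
move=> S; have [r [ur sr Ar]] := simple_pair S S.
have AE d : A ((b \o s) @^-1` [set d]).
  rewrite (_ : _ @^-1` _ =
    [set x | (s x, s x) \in [seq c <- r | b c.1 == d]]).
    exact: algebra_fibers.
  by apply/predeqP => x /=; rewrite mem_filter sr andbT; split=> /eqP.
split; first exact: (AE true).
rewrite (simple_integral_comp hA ba_posU (t := b \o s) (fun d => d%:R)
  (r := [:: true; false]))//; last by move=> x; case: (_ x).
by rewrite big_cons big_seq1 mul1r mul0r addr0.
Qed.

Lemma simple_chebyshev (e : R) (s : Omega -> R) : simple_fun A s -> 0 <= e ->
  e * nu [set x | e < `|s x|] <= simple_integral nu (fun x => `|s x|).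
Proof.
move=> S e0; have [_ <-] := simple_level (fun c => e < `|c|) S.
have S1 := simple_fun1 (fun c => (e < `|c|)%R%:R) S.
rewrite -[leLHS]addr0 -(mul0r (nu setT)) -simple_integral_cst.
rewrite -simple_integral_lin//; last exact: simple_fun_cst.
apply: simple_integral_le => [||x].
- exact: (simple_fun2 (fun c d => e * c + d) S1 (simple_fun_cst 0)).
- exact: simple_fun1.
- by rewrite addr0; case: ltP => [/ltW|_]; rewrite ?mulr1// mulr0.
Qed.

Lemma additive_bigsetU (mu : set Omega -> R) (n : nat) (B : nat -> set Omega) :
  (forall B C, A B -> A C -> B `&` C = set0 -> mu (B `|` C) = mu B + mu C) ->
  (forall i, (i < n)%N -> A (B i)) -> trivIset `I_n B ->
  A (\big[setU/set0]_(i < n) B i) /\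
  mu (\big[setU/set0]_(i < n) B i) = \sum_(i < n) mu (B i).
Proof.
move=> muU; elim: n => [|n IH] AB tB.
  by rewrite !big_ord0 (additive0 hA muU); split=> //; exact: algebra0.
have [||AU muE] := IH; first by move=> i /ltnW; exact: AB.
  by apply: sub_trivIset tB => i /= /ltnW.
rewrite !big_ord_recr/=; split; first by apply: algebraU => //; exact: AB.
rewrite muU ?muE//; first exact: AB.
rewrite predeqE => x; split=> // -[+ Bx].
rewrite -bigcup_mkord => -[i /= ni Bix].
have : i = n by apply: tB => //=; [exact: leqW|exists x].
by move=> e; rewrite e ltnn in ni.
Qed.

(** The definitions of outer measure and of determining sequences pass through the variation of
    their charge; this lets them be read with nu itself. The one-member family E attains the
    supremum, and additivity keeps every other family below nu E. *)
Lemma variation_pos E : A E -> variation_fa A nu E = nu E.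
Proof.
move=> AE; rewrite /variation_fa; set S := (X in sup X).
have SE : S (nu E).
  exists 1%N, (fun=> E); split.
  - by move=> _ _; split.
  - by move=> [|i] [|j].
  - by rewrite big_ord1 ger0_norm// ba_pos_ge0.
have ubS : ubound S (nu E).
  move=> _ [n [B [BE tB ->]]].
  have [||AU nuB] := @additive_bigsetU nu n B _ _ tB.
  - exact: ba_posU.
  - by move=> i /BE[].
  rewrite (eq_bigr (fun i : 'I_n => nu (B i))) => [|i _].
    rewrite -nuB; apply: ba_pos_le => // x.
    by rewrite -bigcup_mkord => -[i /= /BE[_]]; exact.
  by rewrite ger0_norm// ba_pos_ge0//; case: (BE i).
apply/eqP; rewrite eq_le; apply/andP; split.
  by apply: ge_sup => //; exists (nu E).
by apply: ub_le_sup => //; exists (nu E).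
Qed.

End finite_additivity.

(** * Convergence of simple functions in measure and in mean *)

Section integration.
Variables (R : realType) (Omega : Type) (A : set (set Omega)).
Variable nu : set Omega -> R.
Hypotheses (hA : set_algebra A) (nuP : ba_pos A nu).
Implicit Types (f g : Omega -> R) (s t : nat -> Omega -> R).

Local Notation ov := (outer_variation A nu).
Local Notation I0 := (simple_integral nu).
Local Notation I := (integral_fa A nu).
Local Notation L1 := (integrable_fa A nu).

Lemma outer_le E B : A B -> E `<=` B -> ov E <= nu B.
Proof.
move=> AB EB; apply: ge_inf; last by exists B => //; exact: variation_pos.
by exists 0 => _ [C [CA _] <-]; rewrite variation_pos//; exact: (ba_pos_ge0 nuP CA).
Qed.

Lemma outer_inf_nonempty E :
  [set variation_fa A nu B | B in [set B | A B /\ E `<=` B]] !=set0.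
Proof.
by exists (variation_fa A nu setT), setT => //; split=> //; exact: algebraT.
Qed.

Lemma outer_ge0 E : 0 <= ov E.
Proof.
apply: lb_le_inf; first exact: outer_inf_nonempty.
by move=> _ [C [CA _] <-]; rewrite variation_pos//; exact: (ba_pos_ge0 nuP CA).
Qed.

Lemma outer_lt E e : ov E < e -> exists B, [/\ A B, E `<=` B & nu B < e].
Proof.
move=> /inf_lt[|_ [B [AB EB] <-]]; first exact: outer_inf_nonempty.
by rewrite variation_pos// => nuB; exists B.
Qed.

Lemma le_outer E F : E `<=` F -> ov E <= ov F.
Proof.
move=> EF; apply/ler_addgt0Pl => e e0.
have [|B [AB FB nuB]] := @outer_lt F (e + ov F); first by rewrite ltrDr.
by apply: le_trans (ltW nuB); apply: outer_le => // x /EF /FB.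
Qed.

Lemma outerU E F : ov (E `|` F) <= ov E + ov F.
Proof.
apply/ler_addgt0Pl => e e0.
have [|B [AB EB nuB]] := @outer_lt E (e / 2 + ov E); first by rewrite ltrDr divr_gt0.
have [|C [CA FC nuC]] := @outer_lt F (e / 2 + ov F); first by rewrite ltrDr divr_gt0.
apply: (@le_trans _ _ (nu B + nu C)); last by lra.
apply: le_trans (ba_pos_setU hA nuP AB CA).
by apply: outer_le; [exact: algebraU|exact: setUSS].
Qed.

Lemma eq_simple_integral (mu1 mu2 : set Omega -> R) (u : Omega -> R) :
  (forall B, A B -> mu1 B = mu2 B) -> simple_fun A u ->
  simple_integral mu1 u = simple_integral mu2 u.
Proof. by move=> mu12 [_ Au]; apply: eq_fsbigr => c _; rewrite mu12. Qed.

Definition cauchy_mean s := forall e : R, 0 < e ->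
  exists N, forall n k, (N <= n)%N -> (N <= k)%N ->
    I0 (fun x => `|s n x - s k x|) < e.

Definition cvg_outer s f := forall e d : R, 0 < e -> 0 < d ->
  exists N, forall n, (N <= n)%N -> ov [set x | e < `|s n x - f x|] < d.

Lemma determiningE f s : determining A nu f s <->
  [/\ forall n, simple_fun A (s n), cvg_outer s f & cauchy_mean s].
Proof.
have E n k (ss : forall n, simple_fun A (s n)) :
    simple_integral (variation_fa A nu) (fun x => `|s n x - s k x|) =
    I0 (fun x => `|s n x - s k x|).
  apply: eq_simple_integral; first exact: variation_pos.
  exact: (simple_fun2 hA (fun c d => `|c - d|)).
split=> -[ss sf sc]; split=> //.
- move=> e d e0 d0; have /cvg_seq0P := sf e e0; apply => // n.
  exact: outer_ge0.
- by move=> e /sc[N sN]; exists N => n k Nn Nk; rewrite -E//; exact: sN.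
- move=> e e0; apply/cvg_seq0P => [n|d d0]; first exact: outer_ge0.
  exact: sf.
- by move=> e /sc[N sN]; exists N => n k Nn Nk; rewrite E//; exact: sN.
Qed.

Lemma simple_fun_dist (u v : Omega -> R) : simple_fun A u -> simple_fun A v ->
  simple_fun A (fun x => `|u x - v x|).
Proof. exact: (simple_fun2 hA (fun c d => `|c - d|)). Qed.

Lemma simple_fun_norm (u : Omega -> R) : simple_fun A u ->
  simple_fun A (fun x => `|u x|).
Proof. exact: (simple_fun1 hA (fun c => `|c|)). Qed.

Lemma simple_fun_lin a (u v : Omega -> R) : simple_fun A u -> simple_fun A v ->
  simple_fun A (fun x => a * u x + v x).
Proof. exact: (simple_fun2 hA (fun c d => a * c + d)). Qed.

Lemma simple_integral_ge0 (u : Omega -> R) : simple_fun A u ->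
  (forall x, 0 <= u x) -> 0 <= I0 u.
Proof.
move=> su u0; rewrite -(mul0r (nu setT)) -(simple_integral_cst hA nuP 0).
by apply: (simple_integral_le hA nuP) => //; exact: simple_fun_cst.
Qed.

Lemma simple_integral_dist (u v : Omega -> R) :
  simple_fun A u -> simple_fun A v ->
  `|I0 u - I0 v| <= I0 (fun x => `|u x - v x|).
Proof.
have half (w z : Omega -> R) : simple_fun A w -> simple_fun A z ->
    I0 w - I0 z <= I0 (fun x => `|w x - z x|).
  move=> sw sz; have swz := simple_fun_dist sw sz.
  rewrite lerBlDr -[X in X + _]mul1r -(simple_integral_lin hA nuP)//.
  apply: (simple_integral_le hA nuP) => // [|x]; first exact: simple_fun_lin.
  by rewrite mul1r -lerBlDr ler_norm.
move=> su sv; rewrite ler_norml half// andbT lerNl opprB.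
by under eq_fun do rewrite distrC; exact: half.
Qed.

Lemma simple_fun_bounded (u : Omega -> R) : simple_fun A u ->
  exists2 M, 0 <= M & forall x, `|u x| <= M.
Proof.
move=> [/finite_seqP[r rE] _].
exists (\sum_(c <- undup r) `|c|); first exact: sumr_ge0.
move=> x; have : range u (u x) by []; rewrite rE /= -mem_undup => ux.
by rewrite (bigD1_seq (u x)) ?undup_uniq//= lerDl sumr_ge0.
Qed.

(** Applied to the difference of two determining sequences of one function, this makes the integral
    independent of the sequence. *)
Lemma cauchy_mean_null s : (forall n, simple_fun A (s n)) ->
  cvg_outer s (fun=> 0) -> cauchy_mean s ->
  forall e : R, 0 < e -> exists N, forall n, (N <= n)%N -> I0 (fun x => `|s n x|) < e.
Proof.
move=> ss s0 sc e e0; have e3 : 0 < e / 3 by rewrite divr_gt0.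
have [N sN] := sc _ e3.
have [M M0 sM] := simple_fun_bounded (ss N).
have nT : 0 <= nu setT by apply: (ba_pos_ge0 nuP); exact: algebraT.
(* With this d the whole space contributes less than e/3; the summand 1 avoids dividing by a zero
   mass. *)
pose d := e / 3 / (nu setT + 1).
have d0 : 0 < d by rewrite divr_gt0// ltr_wpDl.
have dT : d * nu setT < e / 3.
  by rewrite /d mulrAC ltr_pdivrMr ?ltr_wpDl// ltr_pM2l// ltrDl.
have [||N' sN'] := s0 d (e / 3 / (M + 1)) => //.
  by rewrite divr_gt0// ltr_wpDl.
exists (maxn N N') => n; rewrite geq_max => /andP[Nn Nn'].
have [AE levE] := simple_level hA nuP (fun c => d < `|c|) (ss n).
have small : M * nu [set x | d < `|s n x|] < e / 3.
  have /outer_lt[B [AB EB nuB]] := sN' _ Nn'.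
  have {}nuB : nu [set x | d < `|s n x|] < e / 3 / (M + 1).
    apply: le_lt_trans nuB; apply: (ba_pos_le hA nuP) => // x dx.
    by apply: EB; rewrite /= subr0.
  apply: le_lt_trans (ler_wpM2l M0 (ltW nuB)) _.
  by rewrite mulrA ltr_pdivrMr ?ltr_wpDl// mulrC ltr_pM2l// ltrDl.
pose b x : R := (d < `|s n x|)%R%:R.
have sb : simple_fun A b by exact: (simple_fun1 hA (fun c => (d < `|c|)%R%:R)).
have sd := simple_fun_cst hA d.
have sD := simple_fun_dist (ss n) (ss N).
(* off the set where |s_n| exceeds d the bound is d, and on it |s_N| <= M *)
have : I0 (fun x => `|s n x|) <= I0 (fun x => M * b x + (1 * `|s n x - s N x| + d)).
  apply: (simple_integral_le hA nuP); first exact: simple_fun_norm.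
    by apply: simple_fun_lin => //; exact: simple_fun_lin.
  move=> x; rewrite mul1r /b; case: ltP => [_|sx]; last first.
    by rewrite mulr0 add0r -[leLHS]add0r lerD.
  rewrite mulr1 addrA; apply: (@le_trans _ _ (M + `|s n x - s N x|)).
    have := ler_normD (s N x) (s n x - s N x); rewrite addrC subrK.
    by move=> /le_trans; apply; rewrite lerD2r.
  by rewrite lerDl ltW.
rewrite !(simple_integral_lin hA nuP)//; last exact: simple_fun_lin.
rewrite (simple_integral_cst hA nuP) mul1r levE => /le_lt_trans; apply.
have := sN n N Nn (leqnn N); lra.
Qed.

(** One estimate covers linear combinations, absolute values and truncations. If both arguments move
    by at most e/(2C), then F moves by at most e, so the exceptional set lies in a union of two
    small ones. *)
Lemma determining_lip (F : R -> R -> R) (C : R) f g s t : 0 < C ->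
  (forall a b a' b', `|F a b - F a' b'| <= C * (`|a - a'| + `|b - b'|)) ->
  determining A nu f s -> determining A nu g t ->
  determining A nu (fun x => F (f x) (g x)) (fun n x => F (s n x) (t n x)).
Proof.
move=> C0 FC /determiningE[ss sf sc] /determiningE[st tg tc].
apply/determiningE; split.
- by move=> n; exact: (simple_fun2 hA F).
- move=> e d e0 d0; have e1 : 0 < e / (2 * C) by rewrite divr_gt0// mulr_gt0.
  have d1 : 0 < d / 2 by rewrite divr_gt0.
  have [N sN] := sf _ _ e1 d1; have [N' tN'] := tg _ _ e1 d1.
  exists (maxn N N') => n; rewrite geq_max => /andP[Nn Nn'].
  rewrite [ltRHS]splitr; apply: le_lt_trans (ltrD (sN _ Nn) (tN' _ Nn')).
  apply: le_trans (outerU _ _); apply: le_outer => x /= ex.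
  apply: contrapT => /not_orP[/negP + /negP]; rewrite -!leNgt => sx tx.

  move: ex; apply/negP; rewrite -leNgt; apply: le_trans (FC _ _ _ _) _.
  rewrite -ler_pdivlMl//; apply: le_trans (lerD sx tx) _.
  by rewrite -mulr2n -[leLHS]mulr_natr invfM mulrA [e / 2 / C]mulrAC divfK// mulrC.
- move=> e e0; have e1 : 0 < e / (2 * C) by rewrite divr_gt0// mulr_gt0.
  have [N sN] := sc _ e1; have [N' tN'] := tc _ e1.
  exists (maxn N N') => n k; rewrite !geq_max => /andP[Nn Nn'] /andP[Nk Nk'].
  have D1 := simple_fun_dist (ss n) (ss k); have D2 := simple_fun_dist (st n) (st k).
  have SF m := simple_fun2 hA F (ss m) (st m).
  (* The trailing [+ 0] brings both summands into the form a * u + v that [simple_integral_lin]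
     rewrites. *)
  apply: (@le_lt_trans _ _ (I0 (fun x => C * `|s n x - s k x| +
      (C * `|t n x - t k x| + 0)))).
    apply: (simple_integral_le hA nuP); first exact: simple_fun_dist.
      by do 2![apply: simple_fun_lin => //]; exact: simple_fun_cst.
    by move=> x; rewrite addr0 -mulrDr; exact: FC.
  have S0 := simple_fun_cst hA (0 : R).
  rewrite !(simple_integral_lin hA nuP)//; last exact: simple_fun_lin.
  rewrite (simple_integral_cst hA nuP) mul0r addr0 -mulrDr -ltr_pdivlMl//.
  apply: lt_le_trans (ltrD (sN _ _ Nn Nk) (tN' _ _ Nn' Nk')) _.
  by rewrite -mulr2n -[leLHS]mulr_natr invfM mulrA [e / 2 / C]mulrAC divfK// mulrC.
Qed.

End integration.

(** * The integral as a positive linear functional on L(nu) *)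

Section integral.
Variables (R : realType) (Omega : Type) (A : set (set Omega)).
Variable nu : set Omega -> R.
Hypotheses (hA : set_algebra A) (nuP : ba_pos A nu).
Implicit Types (f g : Omega -> R) (s t : nat -> Omega -> R) (l : R).

Local Notation ov := (outer_variation A nu).
Local Notation I0 := (simple_integral nu).
Local Notation I := (integral_fa A nu).
Local Notation L1 := (integrable_fa A nu).

Lemma determining_cauchy f s : determining A nu f s ->
  exists l : R, I0 (s n) @[n --> \oo] --> l.
Proof.
move=> /(determiningE hA nuP)[ss _ sc]; apply: cauchy_seq_cvg => e /sc[N sN].
exists N => n k Nn Nk; apply: le_lt_trans (sN _ _ Nn Nk).
exact: (simple_integral_dist hA nuP).
Qed.

(** The difference of the two sequences determines f - f = 0, hence tends to 0 in mean. *)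
Lemma determining_unique f s t l : determining A nu f s ->
  determining A nu f t -> I0 (s n) @[n --> \oo] --> l ->
  I0 (t n) @[n --> \oo] --> l.
Proof.
move=> fs ft /cvg_seqP sl; apply/cvg_seqP => e e0.
have F : forall a b a' b' : R, `|(a - b) - (a' - b')| <= 1 * (`|a - a'| + `|b - b'|).
  move=> a b a' b'; rewrite mul1r -[`|b - _|]normrN.
  by rewrite (_ : a - b - _ = (a - a') + - (b - b')) ?ler_normD//; ring.
have := determining_lip hA nuP ltr01 F fs ft.
move=> /(determiningE hA nuP)[ss s0 sc].
have e2 : 0 < e / 2 by rewrite divr_gt0.
rewrite (_ : (fun x => f x - f x) = fun=> 0) in s0; last first.
  by apply/funext => x; rewrite subrr.
have [N sN] := cauchy_mean_null hA nuP ss s0 sc e2.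
have [N' slN'] := sl _ e2.
exists (maxn N N') => n; rewrite geq_max => /andP[Nn Nn'].
rewrite -(subrKA (I0 (s n))) [ltRHS]splitr.
apply: le_lt_trans (ler_normD _ _) (ltrD _ (slN' _ Nn')).
apply: le_lt_trans (sN _ Nn); rewrite distrC.
move: fs ft => /(determiningE hA nuP)[? _ _] /(determiningE hA nuP)[? _ _].
exact: (simple_integral_dist hA nuP).
Qed.

Lemma integral_cvg f s : determining A nu f s -> I0 (s n) @[n --> \oo] --> I f.
Proof.
move=> fs; have [l sl] := determining_cauchy fs.
rewrite /integral_fa; case: xgetP => [i _ [t ft tl]|/(_ l)[]]; last by exists s.
exact: determining_unique ft fs tl.
Qed.

Lemma integral_unique f s l : determining A nu f s ->
  I0 (s n) @[n --> \oo] --> l -> I f = l.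
Proof. by move=> /integral_cvg fs sl; exact: cvg_unique fs sl. Qed.

Lemma integrable_lip (F : R -> R -> R) (C : R) f g : 0 < C ->
  (forall a b a' b', `|F a b - F a' b'| <= C * (`|a - a'| + `|b - b'|)) ->
  L1 f -> L1 g -> L1 (fun x => F (f x) (g x)).
Proof.
move=> C0 FC [s fs] [t gt]; exists (fun n x => F (s n x) (t n x)).
exact: (determining_lip hA nuP C0 FC).
Qed.

Lemma lip_lin (c a b a' b' : R) :
  `|(c * a + b) - (c * a' + b')| <= (`|c| + 1) * (`|a - a'| + `|b - b'|).
Proof.
have -> : c * a + b - (c * a' + b') = c * (a - a') + (b - b') by ring.
apply: le_trans (ler_normD _ _) _; rewrite normrM.
have := normr_ge0 c; have := normr_ge0 (a - a'); have := normr_ge0 (b - b').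
by nra.
Qed.

Lemma lip_norm (a b a' b' : R) :
  `| `|a| - `|a'| | <= 1 * (`|a - a'| + `|b - b'|).
Proof.
by rewrite mul1r; apply: le_trans (ler_dist_dist _ _) _; rewrite lerDl.
Qed.

Lemma determining_lin c f g s t : determining A nu f s -> determining A nu g t ->
  determining A nu (fun x => c * f x + g x) (fun n x => c * s n x + t n x).
Proof.
apply: (determining_lip hA nuP (F := fun a b => c * a + b) _ (lip_lin c)).
by rewrite ltr_wpDl.
Qed.

Lemma determining_norm f s : determining A nu f s ->
  determining A nu (fun x => `|f x|) (fun n x => `|s n x|).
Proof.
by move=> fs; exact: (determining_lip hA nuP ltr01 lip_norm fs fs).
Qed.

Lemma integrable_lin c f g : L1 f -> L1 g -> L1 (fun x => c * f x + g x).
Proof. by move=> [s fs] [t gt]; eexists; exact: determining_lin fs gt. Qed.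

Lemma integrable_norm f : L1 f -> L1 (fun x => `|f x|).
Proof. by move=> [s fs]; eexists; exact: determining_norm fs. Qed.

Lemma integral_lin c f g : L1 f -> L1 g ->
  I (fun x => c * f x + g x) = c * I f + I g.
Proof.
move=> [s fs] [t gt]; apply: integral_unique (determining_lin c fs gt) _.
move: (fs) (gt) => /(determiningE hA nuP)[? _ _] /(determiningE hA nuP)[? _ _].
under eq_fun do rewrite (simple_integral_lin hA nuP)//.
apply: cvgD; last exact: integral_cvg.
by apply: cvgMl_tmp; exact: integral_cvg.
Qed.

Lemma determining_simple (u : Omega -> R) : simple_fun A u ->
  determining A nu u (fun=> u).
Proof.
move=> su; apply/(determiningE hA nuP); split=> // [e d e0 d0|e e0]; exists 0%N.
  move=> n _; apply: le_lt_trans d0.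
  rewrite (_ : [set x | _] = set0) -?(ba_pos0 hA nuP).
    by apply: (outer_le hA nuP) => //; exact: algebra0.
  by rewrite predeqE => x; split=> //=; rewrite subrr normr0 ltNge ltW.
move=> n k _ _; under eq_fun do rewrite subrr normr0.
by rewrite (simple_integral_cst hA nuP) mul0r.
Qed.

Lemma integral_simple (u : Omega -> R) : simple_fun A u -> I u = I0 u.
Proof.
move=> su; apply: integral_unique (determining_simple su) _; exact: cvg_cst.
Qed.

Lemma integrable_simple (u : Omega -> R) : simple_fun A u -> L1 u.
Proof. by move=> su; exists (fun=> u); exact: determining_simple. Qed.

Lemma integrable_cst c : L1 (fun=> c).
Proof. exact/integrable_simple/simple_fun_cst. Qed.

Lemma integral_cst c : I (fun=> c) = c * nu setT.
Proof.
rewrite integral_simple; last exact: simple_fun_cst.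
exact: (simple_integral_cst hA nuP).
Qed.

Lemma integral_ge0 f : L1 f -> (forall x, 0 <= f x) -> 0 <= I f.
Proof.
move=> [s fs] f0; rewrite (_ : f = fun x => `|f x|); last first.
  by apply/funext => x; rewrite ger0_norm.
have := integral_cvg (determining_norm fs); move=> sl.
rewrite -(cvg_lim _ sl)//.
move: (fs) => /(determiningE hA nuP)[ss _ _].
apply: limr_ge; last first.
  apply: nearW => n; apply: (simple_integral_ge0 hA nuP) => //.
  exact: simple_fun_norm.
by apply/cvg_ex; exists (I (fun x => `|f x|)); exact: integral_cvg (determining_norm fs).
Qed.

Lemma integrableB f g : L1 f -> L1 g -> L1 (fun x => f x - g x).
Proof.
move=> fL gL; rewrite (_ : (fun _ => _) = fun x => -1 * g x + f x).
  exact: integrable_lin.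
by apply/funext => x; rewrite mulN1r addrC.
Qed.

Lemma integralB f g : L1 f -> L1 g -> I (fun x => f x - g x) = I f - I g.
Proof.
move=> fL gL; rewrite (_ : (fun _ => _) = fun x => -1 * g x + f x).
  by rewrite integral_lin// mulN1r addrC.
by apply/funext => x; rewrite mulN1r addrC.
Qed.

Lemma integrableD f g : L1 f -> L1 g -> L1 (fun x => f x + g x).
Proof.
move=> fL gL; rewrite (_ : (fun _ => _) = fun x => 1 * f x + g x).
  exact: integrable_lin.
by apply/funext => x; rewrite mul1r.
Qed.

Lemma integralD f g : L1 f -> L1 g -> I (fun x => f x + g x) = I f + I g.
Proof.
move=> fL gL; rewrite (_ : (fun _ => _) = fun x => 1 * f x + g x).
  by rewrite integral_lin// mul1r.
by apply/funext => x; rewrite mul1r.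
Qed.

Lemma integralZ c f : L1 f -> I (fun x => c * f x) = c * I f.
Proof.
move=> fL; have := integral_lin c fL (integrable_cst 0).
rewrite integral_cst mul0r addr0 => <-; congr I.
by apply/funext => x; rewrite addr0.
Qed.

Lemma integrableZ c f : L1 f -> L1 (fun x => c * f x).
Proof.
move=> fL; have := integrable_lin c fL (integrable_cst 0).
by under eq_fun do rewrite addr0.
Qed.

Lemma integral_le f g : L1 f -> L1 g -> (forall x, f x <= g x) -> I f <= I g.
Proof.
move=> fL gL fg; rewrite -subr_ge0 -integralB//; apply: integral_ge0 => [|x].
  exact: integrableB.
by rewrite subr_ge0.
Qed.

Lemma integrable_dist f g : L1 f -> L1 g -> L1 (fun x => `|f x - g x|).
Proof. by move=> fL gL; exact/integrable_norm/integrableB. Qed.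

Lemma integral_dist_triangle f g h : L1 f -> L1 g -> L1 h ->
  I (fun x => `|f x - h x|) <= I (fun x => `|f x - g x|) + I (fun x => `|g x - h x|).
Proof.
move=> fL gL hL; rewrite -integralD; try exact: integrable_dist.
apply: integral_le => [||x]; first exact: integrable_dist.
  by apply: integrableD; exact: integrable_dist.
exact: ler_distD.
Qed.

Lemma integral_distC f g : I (fun x => `|f x - g x|) = I (fun x => `|g x - f x|).
Proof. by congr I; apply/funext => x; rewrite distrC. Qed.

(** For fixed n the functions |s_k - s_n| determine |f - s_n| as k grows, so the Cauchy bound passes
    to the limit. *)
Lemma determining_mean f s : determining A nu f s -> forall e : R, 0 < e ->
  exists N, forall n, (N <= n)%N -> I (fun x => `|f x - s n x|) < e.
Proof.
move=> fs e e0; have /(determiningE hA nuP)[ss _ sc] := fs.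
have e2 : 0 < e / 2 by rewrite divr_gt0.
have [N sN] := sc _ e2; exists N => n Nn.
apply: (@le_lt_trans _ _ (e / 2)); last by rewrite ltr_pdivrMr// ltr_pMr// ltr1n.
have fsn := determining_lin (-1) (determining_simple (ss n)) fs.
have E (x : R) y : -1 * x + y = y - x by rewrite mulN1r addrC.
have := integral_cvg (determining_norm fsn).
under eq_fun do under eq_fun do rewrite E.
under [X in _ --> I X]eq_fun do rewrite E.
move=> sl; rewrite -(cvg_lim _ sl)//; apply: limr_le.
  by apply/cvg_ex; eexists; exact: sl.
by exists N => // k Nk; apply/ltW/sN.
Qed.

Lemma simple_dense f e : L1 f -> 0 < e ->
  exists2 u, simple_fun A u & I (fun x => `|f x - u x|) < e.
Proof.
move=> [s fs] e0; have [N sN] := determining_mean fs e0.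
by exists (s N); [case: fs|exact: sN].
Qed.

(** The set where |f| exceeds e need not belong to A. It is covered by the set in A where a simple
    approximant exceeds e/2 and by the set where the approximation errs by more than e/2; this
    halving is the source of the factor 2. *)
Lemma chebyshev_outer f e : L1 f -> 0 < e ->
  ov [set x | e < `|f x|] <= 2 / e * I (fun x => `|f x|).
Proof.
move=> [s fs] e0; have e2 : 0 < e / 2 by rewrite divr_gt0.
have /(determiningE hA nuP)[ss sf _] := fs.
apply/ler_addgt0Pl => d d0; have d2 : 0 < d / 2 by rewrite divr_gt0.
have [N sN] := sf _ _ e2 d2.
have := integral_cvg (determining_norm fs) => /cvg_seqP.
have d3 : 0 < d / 2 / (2 / e) by rewrite !divr_gt0.
move=> /(_ _ d3)[N' sN']; pose n := maxn N N'.
have [AE _] := simple_level hA nuP (fun c => e / 2 < `|c|) (ss n).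
have sub : [set x | e < `|f x|] `<=`
    [set x | e / 2 < `|s n x|] `|` [set x | e / 2 < `|s n x - f x|].
  move=> x /= ex; apply: contrapT => /not_orP[/negP + /negP].
  rewrite -!leNgt => s1 s2; move: ex; apply/negP; rewrite -leNgt [leRHS]splitr.
  rewrite -[f x](subKr (s n x)); apply: le_trans (ler_normB _ _) _.
  exact: lerD.
apply: le_trans (le_outer hA nuP sub) _; apply: le_trans (outerU hA nuP _ _) _.
have p1 := outer_le hA nuP AE (@subset_refl _ _).
have p2 := simple_chebyshev hA nuP (ss n) (ltW e2).
have p3 := ltW (sN n (leq_maxl _ _)).
have := sN' n (leq_maxr _ _) => /ltr_distlDr p4.
have p5 : nu [set x | e / 2 < `|s n x|] <= 2 / e * I0 (fun x => `|s n x|).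
  by rewrite -ler_pdivrMl ?divr_gt0// invf_div.
apply: le_trans (lerD p1 p3) _; apply: le_trans (lerD p5 (lexx _)) _.
have p6 : 2 / e * I0 (fun x => `|s n x|) <=
    2 / e * (I (fun x => `|f x|) + d / 2 / (2 / e)).
  by rewrite ler_pM2l ?divr_gt0// ltW.
apply: le_trans (lerD p6 (lexx _)) _; rewrite mulrDr.
rewrite [2 / e * (_ / _)]mulrC divfK ?gt_eqF ?divr_gt0//.
by rewrite -addrA -splitr addrC.
Qed.

End integral.

(** * Limits, null functions and truncation in L(nu) *)

Section closure.
Variables (R : realType) (Omega : Type) (A : set (set Omega)).
Variable nu : set Omega -> R.
Hypotheses (hA : set_algebra A) (nuP : ba_pos A nu).
Implicit Types (f g : Omega -> R) (F : nat -> Omega -> R).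

Local Notation ov := (outer_variation A nu).
Local Notation I0 := (simple_integral nu).
Local Notation I := (integral_fa A nu).
Local Notation L1 := (integrable_fa A nu).

Lemma eventually_small (C d : R) : 0 < d ->
  exists N, forall n, (N <= n)%N -> C * n.+1%:R^-1 < d.
Proof.
move=> d0; exists (Num.bound (`|C| / d)) => n Nn.
rewrite ltr_pdivrMr ?ltr0Sn// mulrC -ltr_pdivrMr//.
apply: (@le_lt_trans _ _ (`|C| / d)).
  by rewrite ler_pM2r ?invr_gt0// ler_norm.
apply: lt_le_trans (archi_boundP _) _; first by rewrite divr_ge0// ltW.
by rewrite ler_nat ltnW// ltnS.
Qed.

(** L(nu) need not be complete, so a mean Cauchy sequence has to come with its limit in measure.
    Simple functions within 1/(n+1) of F_n in mean are close to it in measure too, by Chebyshev's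
    inequality, and therefore determine f. *)
Lemma integrable_closed F f : (forall n, L1 (F n)) -> cvg_outer A nu F f ->
  (forall e : R, 0 < e -> exists N, forall n k, (N <= n)%N -> (N <= k)%N ->
     I (fun x => `|F n x - F k x|) < e) ->
  L1 f /\ forall e : R, 0 < e ->
     exists N, forall n, (N <= n)%N -> I (fun x => `|F n x - f x|) < e.
Proof.
move=> FL Ff Fc.
have /choice[s sP] : forall n, exists u, simple_fun A u /\
    I (fun x => `|F n x - u x|) < n.+1%:R^-1.
  move=> n; have [//||u su Fu] := @simple_dense _ _ _ _ hA nuP (F n) n.+1%:R^-1.
    by rewrite invr_gt0 ltr0Sn.
  by exists u.
have sL n : L1 (s n) by apply: integrable_simple => //; case: (sP n).
have fs : determining A nu f s.
  apply/(determiningE hA nuP); split=> [n|e d e0 d0|e e0]; first by case: (sP n).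
    have e2 : 0 < e / 2 by rewrite divr_gt0.
    have d2 : 0 < d / 2 by rewrite divr_gt0.
    have [N FN] := Ff _ _ e2 d2.
    have [N' sN'] := eventually_small (2 / (e / 2)) d2.
    exists (maxn N N') => n; rewrite geq_max => /andP[Nn Nn'].
    apply: (@le_lt_trans _ _ (ov ([set x | e / 2 < `|F n x - s n x|] `|`
        [set x | e / 2 < `|F n x - f x|]))).
      apply: (le_outer hA nuP) => x /= ex.
      apply: contrapT => /not_orP[/negP + /negP]; rewrite -!leNgt => s1 s2.
      move: ex; apply/negP; rewrite -leNgt [leRHS]splitr.
      by apply: le_trans (ler_distD (F n x) _ _) _; rewrite lerD// distrC.
    apply: le_lt_trans (outerU hA nuP _ _) _; rewrite [ltRHS]splitr ltrD ?FN//.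
    apply: le_lt_trans (sN' n Nn').
    have := chebyshev_outer hA nuP (integrableB hA nuP (FL n) (sL n)) e2.
    move=> /le_trans; apply; rewrite ler_pM2l ?divr_gt0//.
    by apply: ltW; case: (sP n).
  have e3 : 0 < e / 3 by rewrite divr_gt0.
  have [N FN] := Fc _ e3; have [N' sN'] := eventually_small 1 e3.
  exists (maxn N N') => n k; rewrite !geq_max => /andP[Nn Nn'] /andP[Nk Nk'].
  rewrite -(integral_simple hA nuP); last first.
    by apply: simple_fun_dist => //; [case: (sP n)|case: (sP k)].
  have := integral_dist_triangle hA nuP (sL n) (FL n) (sL k).
  have := integral_dist_triangle hA nuP (FL n) (FL k) (sL k).
  rewrite (integral_distC _ _ (s n) (F n)).
  have sm m : (N' <= m)%N -> I (fun x => `|F m x - s m x|) < e / 3.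
    by move=> /sN'; rewrite mul1r; apply: lt_trans; case: (sP m).
  have := sm k Nk'; have := sm n Nn'; have := FN n k Nn Nk; lra.
have fL : L1 f by exists s.
split=> // e e0; have e2 : 0 < e / 2 by rewrite divr_gt0.
have [N sN] := determining_mean hA nuP fs e2.
have [N' sN'] := eventually_small 1 e2.
exists (maxn N N') => n; rewrite geq_max => /andP[Nn Nn'].
apply: le_lt_trans (integral_dist_triangle hA nuP (FL n) (sL n) fL) _.
rewrite [ltRHS]splitr ltrD//; last by rewrite integral_distC sN.
by have := sN' n Nn'; rewrite mul1r; apply: lt_trans; case: (sP n).
Qed.

Lemma determining_null f : (forall e : R, 0 < e -> ov [set x | e < `|f x|] = 0) ->
  determining A nu f (fun _ _ => 0).
Proof.
move=> f0; apply/(determiningE hA nuP); split=> [n|e d e0 d0|e e0].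
- exact: simple_fun_cst.
- exists 0%N => n _; rewrite (_ : [set x | _] = [set x | e < `|f x|]) ?f0//.
  by apply/predeqP => x /=; rewrite sub0r normrN.
- exists 0%N => n k _ _; under eq_fun do rewrite subrr normr0.
  by rewrite (simple_integral_cst hA nuP) mul0r.
Qed.

Lemma integral_null f : (forall e : R, 0 < e -> ov [set x | e < `|f x|] = 0) ->
  L1 f /\ I f = 0.
Proof.
move=> /determining_null f0; split; first by eexists; exact: f0.
apply: (integral_unique hA nuP f0); rewrite (simple_integral_cst hA nuP) mul0r.
exact: cvg_cst.
Qed.

(** The zero sequence determines f however large f is on the null set, because only the measure of
    the exceptional sets counts. *)
Lemma integral_null_off f (N : set Omega) : ov N = 0 ->
  (forall x, ~ N x -> f x = 0) -> L1 f /\ I f = 0.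
Proof.
move=> N0 fN; apply: integral_null => e e0.
apply/eqP; rewrite eq_le outer_ge0// andbT -N0; apply: (le_outer hA nuP) => x /=.
by apply: contraPP => /fN ->; rewrite normr0; apply/negP; rewrite -leNgt ltW.
Qed.

Definition excess (c : R) f x := Num.max (f x - c) 0.

Lemma lip_excess (c a b a' b' : R) :
  `|Num.max (a - c) 0 - Num.max (a' - c) 0| <= 1 * (`|a - a'| + `|b - b'|).
Proof.
rewrite mul1r; apply: (@le_trans _ _ `|a - a'|); last by rewrite lerDl.
have := ler_norm (a - a'); have := ler_norm (a' - a); rewrite distrC => h1 h2.
by rewrite ler_norml /Num.max; case: ltP => ?; case: ltP => ?; apply/andP; split; lra.
Qed.

Lemma integrable_excess c f : L1 f -> L1 (excess c f).
Proof. by move=> fL; exact: (integrable_lip hA nuP ltr01 (lip_excess c) fL fL). Qed.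

Lemma excess_ge0 c f x : 0 <= excess c f x.
Proof. by rewrite /excess le_max lexx orbT. Qed.

(** If u is simple with |u| <= M <= c, then (f - c)^+ <= |f - u| pointwise. This takes the place of
    dominated convergence. *)
Lemma integral_excess_small f e : L1 f -> 0 < e ->
  exists2 M, 0 <= M & forall c, M <= c -> I (excess c f) < e.
Proof.
move=> fL e0; have [u su fu] := simple_dense hA nuP fL e0.
have [M M0 uM] := simple_fun_bounded su.
exists M => // c Mc; apply: le_lt_trans fu; apply: (integral_le hA nuP).
- exact: integrable_excess.
- by apply: integrable_dist => //; exact: integrable_simple.
move=> x; rewrite /excess ge_max normr_ge0 andbT.
have := ler_norm (f x - u x); have := le_trans (ler_norm _) (uM x); lra.
Qed.

End closure.

(** * The total variation of a signed charge *)

Section variation.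
Variables (R : realType) (Omega : Type) (A : set (set Omega)).
Variable mu : set Omega -> R.
Hypotheses (hA : set_algebra A) (muP : ba A mu).

Local Notation V := (variation_fa A mu).

Let sums (E : set Omega) := [set r : R | exists (n : nat) (B : nat -> set Omega),
  [/\ forall i, (i < n)%N -> A (B i) /\ B i `<=` E,
      trivIset `I_n B & r = \sum_(i < n) `|mu (B i)|]].

Lemma baU B C : A B -> A C -> B `&` C = set0 -> mu (B `|` C) = mu B + mu C.
Proof. by case: muP => + _; exact. Qed.

(** Grouping the members of a disjoint family by the sign of mu turns the sum of |mu B_i| into mu of
    one union minus mu of another, each at most M in absolute value. *)
Lemma variation_sums_ub E : has_ubound (sums E).
Proof.
have [_ [M muM]] := muP; exists (M + M) => _ [n [B [BE tB ->]]].
pose P (b : bool) i := if (0 <= mu (B i)) == b then B i else set0.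
have sP b : A (\big[setU/set0]_(i < n) P b i) /\
    mu (\big[setU/set0]_(i < n) P b i) = \sum_(i < n) mu (P b i).
  apply: (additive_bigsetU hA baU) => [i ni|i j ni nj].
    by rewrite /P; case: ifP => _; [case: (BE i ni)|exact: algebra0].
  rewrite /P; case: ifP => _; case: ifP => _; rewrite ?set0I ?setI0; try by case.
  exact: tB.
rewrite (eq_bigr (fun i : 'I_n => mu (P true i) - mu (P false i))); last first.
  move=> i _; rewrite /P; case: ltP => m0 /=; rewrite (additive0 hA baU).
    by rewrite sub0r ltr0_norm.
  by rewrite subr0 ger0_norm.
rewrite sumrB; have [AU <-] := sP true; have [AU' <-] := sP false.
apply: lerD; first exact: le_trans (ler_norm _) (muM _ AU).
by apply: le_trans (muM _ AU'); rewrite -normrN ler_norm.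
Qed.

Lemma variation_sums_nonempty E : sums E !=set0.
Proof. by exists 0, 0%N, (fun=> set0); split=> //; rewrite big_ord0. Qed.

Lemma variation_ge E r : sums E r -> r <= V E.
Proof. exact: (ub_le_sup (variation_sums_ub E)). Qed.

Lemma variation_le E r : ubound (sums E) r -> V E <= r.
Proof. exact: (ge_sup (variation_sums_nonempty E)). Qed.

Lemma variation_sumsU B C r1 r2 : B `&` C = set0 -> sums B r1 -> sums C r2 ->
  sums (B `|` C) (r1 + r2).
Proof.
move=> BC0 [n1 [B1 [BB tB1 ->]]] [n2 [B2 [BC tB2 ->]]].
exists (n1 + n2)%N, (fun i => if (i < n1)%N then B1 i else B2 (i - n1)%N); split.
- move=> i ni; case: ltnP => i1.
    by have [AB iB] := BB _ i1; split=> // x /iB; left.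
  have [|AB iC] := BC (i - n1)%N; first by rewrite ltn_subLR.
  by split=> // x /iC; right.
- have disj i j x : (i < n1)%N -> (j - n1 < n2)%N -> B1 i x -> B2 (j - n1)%N x -> False.
    move=> /BB[_ iB] /BC[_ iC] /iB Bx /iC Cx.
    by have : (B `&` C) x by []; rewrite BC0.
  move=> i j /= ni nj; case: ltnP => i1; case: ltnP => j1 [x [xi xj]].
  + by apply: tB1 => //; exists x.
  + by case: (disj i j x) => //; rewrite ltn_subLR.
  + by case: (disj j i x) => //; rewrite ltn_subLR.
  + have : (i - n1)%N = (j - n1)%N.
      by apply: tB2; rewrite /= ?ltn_subLR//; exists x.
    by move=> /(congr1 (addn n1)); rewrite !subnKC.
- rewrite big_split_ord/=; congr +%R; apply: eq_bigr => i _ /=.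
    by rewrite ltn_ord.
  by rewrite ltnNge leq_addr/= addKn.
Qed.

(** Cutting a family inside the union along B and C bounds its variation from above; concatenating a
    family in B with one in C bounds it from below. *)
Lemma variation_ba_pos : ba_pos A V.
Proof.
have V0 E : 0 <= V E.
  by apply: variation_ge; exists 0%N, (fun=> set0); split=> //; rewrite big_ord0.
split; last by move=> B _; exact: V0.
split=> [B C AB AC0 BC0|]; last first.
  exists (V setT) => B AB; rewrite ger0_norm//.
  apply: variation_le => _ [n [D [DB tD ->]]]; apply: variation_ge.
  by exists n, D; split=> // i /DB[].
apply/eqP; rewrite eq_le; apply/andP; split.
  apply: variation_le => _ [n [D [DE tD ->]]].
  apply: (@le_trans _ _
    (\sum_(i < n) `|mu (D i `&` B)| + \sum_(i < n) `|mu (D i `&` C)|)).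
    rewrite -big_split; apply: ler_sum => i _ /=; have [AD DBC] := DE i (ltn_ord i).
    apply: le_trans (ler_normD _ _); rewrite -baU; try exact: algebraI.
      by rewrite -setIUr setIidl.
    by rewrite setIACA BC0 setI0.
  have sumsI E : A E -> sums E (\sum_(i < n) `|mu (D i `&` E)|).
    move=> AE; exists n, (fun i => D i `&` E); split=> [i ni|i j ni nj [x [[? _] [? _]]]|//].
      by split=> [|x []//]; apply: algebraI => //; case: (DE i ni).
    by apply: tD => //; exists x.
  by apply: lerD; apply: variation_ge; exact: sumsI.
rewrite -lerBrDr; apply: variation_le => r1 s1; rewrite lerBrDr addrC -lerBrDr.
apply: variation_le => r2 s2; rewrite lerBrDr addrC.
by apply: variation_ge; exact: variation_sumsU.
Qed.

Lemma outer_variationE E : outer_variation A mu E = outer_variation A V E.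
Proof.
rewrite /outer_variation; congr inf; apply/seteqP.
by split=> _ [B [AB EB] <-]; exists B => //; rewrite (variation_pos hA variation_ba_pos).
Qed.

(** V agrees with its own variation on A, so integrability depends on mu only through |mu|;
    questions about L(mu) thus reduce to a nonnegative charge. *)
Lemma integrable_variationE : integrable_fa A mu = integrable_fa A V.
Proof.
suff E f s : determining A mu f s <-> determining A V f s.
  by apply/predeqP => f; split=> -[s /E fs]; exists s.
have I0E (u : Omega -> R) : simple_fun A u ->
    simple_integral (variation_fa A V) u = simple_integral V u.
  by apply: eq_simple_integral => B AB; rewrite (variation_pos hA variation_ba_pos).
split=> -[ss sf sc]; split=> //.
- by move=> e e0; under eq_fun do rewrite -outer_variationE; exact: sf.
- move=> e /sc[N sN]; exists N => n k Nn Nk.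
  by rewrite I0E; [exact: sN|exact: simple_fun_dist].
- by move=> e e0; under eq_fun do rewrite outer_variationE; exact: sf.
- move=> e /sc[N sN]; exists N => n k Nn Nk.
  by rewrite -I0E; [exact: sN|exact: simple_fun_dist].
Qed.

End variation.

(** * Representation of positive functionals on bounded functions *)

Section hahn_banach.
Variables (R : realType) (V : lmodType R) (D : set V).
Hypotheses (D0 : D 0) (Dlin : forall (a : R) f g, D f -> D g -> D (a *: f + g)).

Let DD f g : D f -> D g -> D (f + g).
Proof. by move=> Df Dg; rewrite -(scale1r f); exact: Dlin. Qed.

Let DZ a f : D f -> D (a *: f).
Proof. by move=> Df; rewrite -(addr0 (_ *: _)); exact: Dlin. Qed.

Let DN f : D f -> D (- f).
Proof. by move=> Df; rewrite -scaleN1r; exact: DZ. Qed.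

Definition sublinear_on (q : V -> R) :=
  (forall f g, D f -> D g -> q (f + g) <= q f + q g) /\
  (forall a f, 0 <= a -> D f -> q (a *: f) <= a * q f).

Lemma sublinear0 q : sublinear_on q -> q 0 = 0.
Proof.
move=> [qD qZ]; have q0 : q 0 <= 0.
  by have := qZ 0 0 (lexx _) D0; rewrite scale0r mul0r.
by apply/eqP; rewrite eq_le q0/=; have := qD 0 0 D0 D0; rewrite addr0 lerDl.
Qed.

Lemma sublinearN q f : sublinear_on q -> D f -> - q (- f) <= q f.
Proof.
move=> sq Df; rewrite lerNl -subr_ge0 opprK -(sublinear0 sq) -(addNr f).
by case: sq => + _; apply => //; exact: DN.
Qed.

Lemma le_mul_inf (S : set R) (a x : R) : S !=set0 -> 0 <= a ->
  (forall s, S s -> x <= a * s) -> x <= a * inf S.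
Proof.
move=> S0; rewrite le_eqVlt => /orP[/eqP <-|a0] xS.
  by case: S0 => s /xS; rewrite !mul0r.
rewrite -ler_pdivrMl//; apply: lb_le_inf => // s /xS.
by rewrite ler_pdivrMl.
Qed.

Lemma le_inf_add (S1 S2 : set R) (x : R) : S1 !=set0 -> S2 !=set0 ->
  (forall s t, S1 s -> S2 t -> x <= s + t) -> x <= inf S1 + inf S2.
Proof.
move=> S10 S20 xS; rewrite -lerBlDr; apply: lb_le_inf => // s Ss.
rewrite lerBlDr addrC -lerBlDr; apply: lb_le_inf => // t St.
by rewrite lerBlDr addrC; exact: xS.
Qed.

Variable p : V -> R.
Hypothesis psub : sublinear_on p.

(** Vanishing outside D makes comparison on all of V the same as comparison on D, so that minorants
    agreeing on D are equal. *)
Let minorant := {q : V -> R | [/\ sublinear_on q, forall f, D f -> q f <= p f &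
  forall f, ~ D f -> q f = 0]}.

Let restrict (q : V -> R) f := if `[< D f >] then q f else 0.

Let restrictE q f : D f -> restrict q f = q f.
Proof. by move=> Df; rewrite /restrict asboolT. Qed.

Let restrict_minorant (q : V -> R) : sublinear_on q ->
  (forall f, D f -> q f <= p f) ->
  [/\ sublinear_on (restrict q), forall f, D f -> restrict q f <= p f &
    forall f, ~ D f -> restrict q f = 0].
Proof.
move=> [qD qZ] qp; split=> [|f Df|f Df].
- split=> [f g Df Dg|a f a0 Df]; rewrite !restrictE//; try by [exact: DD|exact: DZ].
    exact: qD.
  exact: qZ.
- by rewrite restrictE// qp.
- by rewrite /restrict asboolF.
Qed.

(* A minimal sublinear minorant is superadditive, hence linear: for fixed g
   the functional f |-> inf_t (q (f + t g) - t q g) is again a sublinear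
   minorant. *)
Lemma hahn_banach_minorant : exists q : V -> R,
  (forall (a : R) f g, D f -> D g -> q (a *: f + g) = a * q f + q g) /\
  (forall f, D f -> q f <= p f).
Proof.
(* The order is reversed, so that Zorn's lemma yields a minimal minorant. *)
pose rel (s t : minorant) := `[< forall f, sval t f <= sval s f >].
have [||||[q [qsub qp q0]] qmin] := @Zorn minorant rel.
- by move=> t; apply/asboolP.
- move=> r s t /asboolP rs /asboolP st; apply/asboolP => f.
  exact: le_trans (st f) (rs f).
- move=> [s sP] [t tP] /asboolP st /asboolP ts; apply: eq_exist.
  by apply/funext => f; apply/eqP; rewrite eq_le st ts.
- move=> C Ctot; have [[s0 Cs0]|C0] := pselect (C !=set0); last first.
    exists (exist _ (restrict p) (restrict_minorant psub (fun f _ => lexx _))) => s Cs.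
    by case: C0; exists s.
  pose t f := inf [set sval s f | s in C].
  have tne f : [set sval s f | s in C] !=set0 by exists (sval s0 f), s0.
  have tle s f : C s -> D f -> t f <= sval s f.
    move=> Cs Df; apply: ge_inf; last by exists s.
    (* Every member u of the chain satisfies - p (- f) <= - u (- f) <= u f, so the infimum is
       finite. *)
    exists (- p (- f)) => _ [[u [usub up u0]] /= _ <-].
    apply: le_trans (sublinearN usub Df); rewrite lerN2.
    exact/up/DN.
  have tsub : sublinear_on t.
    split=> [f g Df Dg|a f a0 Df]; last first.
      apply: le_mul_inf => // _ [s Cs <-].
      apply: le_trans (tle _ _ Cs (DZ _ Df)) _.
      by case: s {Cs} => s [[_ sZ] _ _] /=; exact: sZ.
    apply: le_inf_add => // _ _ [s Cs <-] [s' Cs' <-].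
    have [r [Cr rs rs']] : exists r, [/\ C r, forall f, sval r f <= sval s f &
        forall f, sval r f <= sval s' f].
      by case: (Ctot _ _ Cs Cs') => /asboolP h; [exists s'|exists s].
    apply: le_trans (tle _ _ Cr (DD Df Dg)) _.
    apply: le_trans (lerD (rs f) (rs' g)).
    by case: r {Cr rs rs'} => r [[rD _] _ _] /=; exact: rD.
  have tp f : D f -> t f <= p f.
    move=> Df; apply: le_trans (tle _ _ Cs0 Df) _.
    by case: (s0) => s [_ sp _] /=; exact: sp.
  exists (exist _ (restrict t) (restrict_minorant tsub tp)) => s Cs; apply/asboolP => f /=.
  have [Df|Df] := pselect (D f); first by rewrite restrictE//; exact: tle.
  by rewrite /restrict asboolF//; case: s {Cs} => s [_ _ s0'] /=; rewrite s0'.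
have qD f g : D f -> D g -> q f + q g <= q (f + g).
  move=> Df Dg.
  pose S h := [set q (h + t *: g) - t * q g | t in [set t : R | 0 <= t]].
  pose qg h := inf (S h).
  have Sne h : S h !=set0 by exists (q (h + 0 *: g) - 0 * q g), 0 => //=.
  have qgle h t : 0 <= t -> D h -> qg h <= q (h + t *: g) - t * q g.
    move=> t0 Dh; apply: ge_inf; last by exists t.
    exists (- q (- h)) => _ [u /= u0 <-].
    rewrite lerBrDr addrC lerBlDr; have [qD qZ] := qsub.
    apply: (@le_trans _ _ (q (u *: g))); last first.
      rewrite -[X in q X](addrK h) [u *: g + h]addrC.
      by apply: qD; [apply: DD => //; exact: DZ|exact: DN].
    have [->|un0] := eqVneq u 0; first by rewrite mul0r scale0r sublinear0.
    have := qZ u^-1 (u *: g); rewrite scalerA mulVf// scale1r invr_ge0 => /(_ u0).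
    by move=> /(_ (DZ _ Dg)); rewrite ler_pdivlMl// lt_def un0.
  have qgsub : sublinear_on qg.
    have [qD qZ] := qsub; split=> [h k Dh Dk|a h a0 Dh].
      apply: le_inf_add => // _ _ [t /= t0 <-] [u /= u0 <-].
      apply: le_trans (qgle _ (t + u) _ _) _; [exact: addr_ge0|exact: DD|].
      rewrite addrACA -opprD -mulrDl lerD2r scalerDl addrACA.
      by apply: qD; apply: DD => //; exact: DZ.
    apply: le_mul_inf => // _ [t /= t0 <-].
    apply: le_trans (qgle _ (a * t) _ (DZ _ Dh)) _; first exact: mulr_ge0.
    rewrite mulrBr mulrA lerD2r -scalerA -scalerDr; apply: qZ => //.
    by apply: DD => //; exact: DZ.
  have qgq h : D h -> qg h <= q h.
    by move=> Dh; have := qgle h 0 (lexx _) Dh; rewrite scale0r addr0 mul0r subr0.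
  have qgp h : D h -> qg h <= p h.
    by move=> Dh; exact: le_trans (qgq h Dh) (qp h Dh).
  (* Minimality forces [qg] = q on D; the term t = 1 of the infimum is then superadditivity. *)
  have := qmin (exist _ (restrict qg) (restrict_minorant qgsub qgp)).
  move=> /(_ _)/(congr1 (fun s => sval s f))/= <-; last first.
    apply/asboolP => h /=; have [Dh|Dh] := pselect (D h).
      by rewrite restrictE// qgq.
    by rewrite /restrict asboolF// q0.
  rewrite restrictE// -lerBrDr; have := qgle f 1 ler01 Df.
  by rewrite scale1r mul1r.
have qadd f g : D f -> D g -> q (f + g) = q f + q g.
  move=> Df Dg; apply/eqP; rewrite eq_le qD// andbT.
  by have [+ _] := qsub; exact.
have qN f : D f -> q (- f) = - q f.
  move=> Df; apply/eqP; rewrite -addr_eq0 -qadd//; last exact: DN.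
  by rewrite addNr sublinear0.
have qpos a f : 0 <= a -> D f -> q (a *: f) = a * q f.
  move=> a0 Df; have [_ qZ] := qsub; apply/eqP; rewrite eq_le qZ//=.
  have := qZ a (- f) a0 (DN Df); rewrite scalerN !qN ?mulrN ?lerN2//.
  exact: DZ.
exists q; split=> // a f g Df Dg; rewrite qadd//; last exact: DZ.
congr (_ + _); have [a0|/ltW a0] := leP 0 a; first exact: qpos.
rewrite -[a]opprK scaleNr qN; last exact: DZ.
by rewrite qpos ?mulNr// oppr_ge0.
Qed.

End hahn_banach.

(** * Positive functionals on a function lattice and their extension *)

Section sublattice.
Variables (R : realType) (Omega : Type) (L : set (Omega -> R)).
Variable phi : (Omega -> R) -> R.
Hypotheses (hL : vector_sublattice L) (LT : L (cst 1)).
Hypothesis phiP : positive_linear L phi.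
Implicit Types (f g : Omega -> R).

Lemma lattice_lin (a : R) f g : L f -> L g -> L (fun x => a * f x + g x).
Proof. by case: hL => _ + _ _; exact. Qed.

Lemma lattice_cst (c : R) : L (fun=> c).
Proof.
have [L0 _ _ _] := hL; have := lattice_lin c LT L0.
by rewrite /cst /= mulr1 addr0.
Qed.

Lemma latticeD f g : L f -> L g -> L (fun x => f x + g x).
Proof.
by move=> Lf Lg; have := lattice_lin 1 Lf Lg; under eq_fun do rewrite mul1r.
Qed.

Lemma latticeZ (a : R) f : L f -> L (fun x => a * f x).
Proof.
move=> Lf; have := lattice_lin a Lf (lattice_cst 0).
by under eq_fun do rewrite addr0.
Qed.

Lemma latticeB f g : L f -> L g -> L (fun x => f x - g x).
Proof.
move=> Lf Lg; have := lattice_lin (-1) Lg Lf.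
by under eq_fun do rewrite mulN1r addrC.
Qed.

Lemma lattice_max f g : L f -> L g -> L (fun x => Num.max (f x) (g x)).
Proof. by case: hL => _ _ + _; exact. Qed.

Lemma lattice_min f g : L f -> L g -> L (fun x => Num.min (f x) (g x)).
Proof. by case: hL => _ _ _; exact. Qed.

Lemma lattice_excess c f : L f -> L (excess c f).
Proof.
by move=> Lf; apply: lattice_max; [apply: latticeB => //|]; exact: lattice_cst.
Qed.

Lemma lattice_norm f : L f -> L (fun x => `|f x|).
Proof.
move=> Lf; rewrite (_ : (fun _ => _) = fun x => Num.max (f x) (-1 * f x)).
  by apply: lattice_max => //; exact: latticeZ.
by apply/funext => x; rewrite mulN1r maxrN.
Qed.

Lemma positive_linearE (a : R) f g : L f -> L g ->
  phi (fun x => a * f x + g x) = a * phi f + phi g.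
Proof. by case: phiP => + _; exact. Qed.

Lemma positive_ge0 f : L f -> (forall x, 0 <= f x) -> 0 <= phi f.
Proof. by case: phiP => _; exact. Qed.

Lemma positive0 : phi (fun=> 0) = 0.
Proof.
have L0 := lattice_cst 0.
have := positive_linearE 1 L0 L0; rewrite mulr0 addr0 mul1r => e.
by apply: (@addIr _ (phi (fun=> 0))); rewrite -e add0r.
Qed.

Lemma positiveZ (a : R) f : L f -> phi (fun x => a * f x) = a * phi f.
Proof.
move=> Lf; have := positive_linearE a Lf (lattice_cst 0).
by rewrite positive0 addr0 => <-; congr phi; apply/funext => x; rewrite addr0.
Qed.

Lemma positiveD f g : L f -> L g -> phi (fun x => f x + g x) = phi f + phi g.
Proof.
move=> Lf Lg; have := positive_linearE 1 Lf Lg; rewrite mul1r => <-.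
by congr phi; apply/funext => x; rewrite mul1r.
Qed.

Lemma positiveB f g : L f -> L g -> phi (fun x => f x - g x) = phi f - phi g.
Proof.
move=> Lf Lg; have := positive_linearE (-1) Lg Lf.
rewrite mulN1r [RHS]addrC => <-.
by congr phi; apply/funext => x; rewrite mulN1r addrC.
Qed.

Lemma positive_le f g : L f -> L g -> (forall x, f x <= g x) -> phi f <= phi g.
Proof.
move=> Lf Lg fg; rewrite -subr_ge0 -positiveB//; apply: positive_ge0 => [|x].
  exact: latticeB.
by rewrite subr_ge0.
Qed.

Lemma positive_cst (c : R) : phi (fun=> c) = c * phi (cst 1).
Proof.
by rewrite -positiveZ//; congr phi; apply/funext => x; rewrite /cst mulr1.
Qed.

Lemma positive_norm f : L f -> `|phi f| <= phi (fun x => `|f x|).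
Proof.
move=> Lf; have Lnf := lattice_norm Lf.
rewrite ler_norml; apply/andP; split; last first.
  by apply: positive_le => // x; exact: ler_norm.
rewrite lerNl -mulN1r -positiveZ//; apply: positive_le => // [|x].
  exact: latticeZ.
by rewrite mulN1r -normrN ler_norm.
Qed.

(** The infimum p f of phi over the majorants of f in L is sublinear, and finite on functions
    dominated by L. A linear q below p is positive, since p (- f) <= phi 0 = 0 for f >= 0; it agrees
    with phi on L, since p <= phi there and L is stable under negation. *)
Lemma positive_extension : exists q : (Omega -> R) -> R,
  let D := [set f | exists2 h, L h & forall x, `|f x| <= h x] in
  positive_linear D q /\ forall f, L f -> q f = phi f.
Proof.
pose D := [set f : Omega -> R^o | exists2 h, L h & forall x, `|f x| <= h x].
pose up f := [set phi h | h in [set h | L h /\ forall x, f x <= h x]].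
pose p f := inf (up f).
have upne f : D f -> up f !=set0.
  move=> [h Lh fh]; exists (phi h), h => //; split=> // x.
  exact: le_trans (ler_norm _) (fh x).
have ple f h : D f -> L h -> (forall x, f x <= h x) -> p f <= phi h.
  move=> [k Lk fk] Lh fh; apply: ge_inf; last by exists h.
  exists (phi (fun x => -1 * k x)) => _ [u [Lu fu] <-].
  apply: positive_le => // [|x]; first exact: latticeZ.
  rewrite mulN1r; apply: le_trans (fu x).
  by rewrite lerNl; apply: le_trans (fk x); rewrite -normrN ler_norm.
have D0 : D 0.
  by exists (fun=> 0) => [|x]; [exact: lattice_cst|rewrite normr0].
have Dlin (a : R) (f g : Omega -> R^o) : D f -> D g -> D (a *: f + g).
  move=> [h Lh fh] [k Lk gk]; exists (fun x => `|a| * h x + k x).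
    exact: lattice_lin.
  move=> x; apply: le_trans (ler_normD _ _) _; rewrite lerD//.
  by rewrite normrM ler_wpM2l.
have psub : sublinear_on D p.
  split=> [f g Df Dg|a f a0 Df].
    apply: le_inf_add => [||_ _ [h [Lh fh] <-] [k [Lk gk] <-]]; try exact: upne.
    rewrite -positiveD//; apply: ple => [||x].
    - by rewrite -(scale1r f); exact: Dlin.
    - exact: latticeD.
    - exact: lerD.
  apply: le_mul_inf => //; first exact: upne.
  move=> _ [h [Lh fh] <-]; rewrite -positiveZ//; apply: ple => [||x].
  - by rewrite -[_ *: _]addr0; exact: Dlin.
  - exact: latticeZ.
  - exact: ler_wpM2l.
have [q [qlin qp]] := hahn_banach_minorant D0 Dlin psub.
have qN f : D f -> q (- f) = - q f.
  move=> Df; have q0 : q 0 = 0.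
    have := qlin 1 0 0 D0 D0; rewrite scaler0 addr0 mul1r => e.
    by apply: (@addIr _ (q 0)); rewrite -e add0r.
  by have := qlin (-1) f 0 Df D0; rewrite q0 !addr0 mulN1r scaleN1r.
have DN f : D f -> D (- f).
  by move=> Df; have := Dlin (-1) f 0 Df D0; rewrite addr0 scaleN1r.
exists q; split=> [|f Lf].
  split=> [a f g Df Dg|f Df f0]; first exact: qlin.
  rewrite -oppr_le0 -qN//; apply: le_trans (qp _ (DN _ Df)) _.
  rewrite -[leRHS]positive0; apply: ple => [||x]; first exact: DN.
    exact: lattice_cst.
  by rewrite oppr_le0.
have Df : D f by exists (fun x => `|f x|) => //; exact: lattice_norm.
apply/eqP; rewrite eq_le; apply/andP; split.
  by apply: le_trans (qp _ Df) _; exact: ple.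
rewrite -lerN2 -qN//; apply: le_trans (qp _ (DN _ Df)) _.
rewrite -[leRHS]mulN1r -positiveZ//; apply: ple => [||x]; first exact: DN.
  exact: latticeZ.
by rewrite mulN1r.
Qed.

End sublattice.

(** * Integrability through truncations *)

Section truncation.
Variables (R : realType) (Omega : Type) (A : set (set Omega)).
Variable nu : set Omega -> R.
Hypotheses (hA : set_algebra A) (nuP : ba_pos A nu).
Implicit Types (f g : Omega -> R).

Local Notation ov := (outer_variation A nu).
Local Notation I := (integral_fa A nu).
Local Notation L1 := (integrable_fa A nu).

Lemma integral_dist f g : L1 f -> L1 g -> `|I f - I g| <= I (fun x => `|f x - g x|).
Proof.
have half u v : L1 u -> L1 v -> I u - I v <= I (fun x => `|u x - v x|).
  move=> uL vL; rewrite -(integralB hA nuP)//; apply: (integral_le hA nuP).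
  - exact: integrableB.
  - exact: integrable_dist.
  - by move=> x; rewrite ler_norm.
move=> fL gL; rewrite ler_norml half// andbT lerNl opprB integral_distC.
exact: half.
Qed.

Lemma min_excess (a c : R) : a - Num.min a c = Num.max (a - c) 0.
Proof. by case: (leP a c) => ac; [rewrite max_r|rewrite max_l]; lra. Qed.

Lemma integral_min_cvg f : L1 f ->
  (forall n, L1 (fun x => Num.min (f x) n%:R)) ->
  I (fun x => Num.min (f x) n%:R) @[n --> \oo] --> I f.
Proof.
move=> fL fnL; apply/cvg_seqP => e e0.
have [M M0 fM] := integral_excess_small hA nuP fL e0.
exists (Num.bound M) => n Mn; rewrite distrC -(integralB hA nuP)//.
under eq_fun do rewrite min_excess.
rewrite ger0_norm.
  by apply: fM; apply: ltW; apply: lt_le_trans (archi_boundP M0) _; rewrite ler_nat.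
apply: (integral_ge0 hA nuP); first exact: integrable_excess.
exact: excess_ge0.
Qed.

(** The bound C acts twice: by Chebyshev's inequality the set where f exceeds n + 1 has outer
    measure at most 4 C / (n + 1), and the integrals, increasing and bounded, converge, so the
    truncations are Cauchy in mean. *)
Lemma integrable_of_min f (C : R) : (forall x, 0 <= f x) ->
  (forall n, L1 (fun x => Num.min (f x) n%:R)) ->
  (forall n, I (fun x => Num.min (f x) n%:R) <= C) -> L1 f.
Proof.
move=> f0 fnL fnC; pose F n x := Num.min (f x) n.+1%:R.
have F0 n x : 0 <= F n x by rewrite le_min f0 ler0n.
have Fmono x : {homo F^~ x : n k / (n <= k)%N >-> n <= k}.
  move=> n k nk; rewrite /F le_min ge_min lexx/= ge_min orbC.
  by rewrite (_ : n.+1%:R <= k.+1%:R)// ler_nat.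
have IFmono : {homo (fun n => I (F n)) : n k / (n <= k)%N >-> n <= k}.
  by move=> n k nk; apply: (integral_le hA nuP) => [||x]; try exact: fnL; exact: Fmono.
have [||fL _] // := @integrable_closed _ _ _ _ hA nuP F f (fun n => fnL n.+1).
  move=> e d e0 d0; have [N CN] := eventually_small (4 * C) d0.
  exists N => n /CN; apply: le_lt_trans.
  have n0 : 0 < n.+1%:R / 2 :> R by rewrite divr_gt0 ?ltr0Sn.
  (* Where the truncation differs from f it equals n + 1; the half makes the inequality strict. *)
  have sub : [set x | e < `|F n x - f x|] `<=` [set x | n.+1%:R / 2 < `|F n x|].
    move=> x /=; rewrite /F; case: (leP (f x) n.+1%:R) => [_|fn _].
      by rewrite subrr normr0 ltNge ltW.
    by rewrite ger0_norm ?ler0n// ltr_pdivrMr// ltr_pMr ?ltr0Sn// ltr1n.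
  apply: le_trans (le_outer hA nuP sub) _.
  apply: le_trans (chebyshev_outer hA nuP (fnL n.+1) n0) _.
  rewrite (_ : 2 / (n.+1%:R / 2) = 4 / n.+1%:R); last first.
    by rewrite invf_div mulrA -natrM.
  rewrite mulrAC ler_pM2r ?invr_gt0 ?ltr0Sn// ler_pM2l//.
  rewrite (_ : (fun x => `|F n x|) = F n); first exact: fnC.
  by apply/funext => x; rewrite ger0_norm.
move=> e e0.
have /cvg_ex[l /cvg_seqP Il] : cvgn (fun n => I (F n)).
  apply: nondecreasing_is_cvgn; first exact: IFmono.
  by exists C => _ [n _ <-]; exact: (fnC n.+1).
have [N IN] := Il (e / 2) (divr_gt0 e0 (ltr0Sn _ 1)).
have wl n k : (N <= n)%N -> (n <= k)%N -> I (fun x => `|F k x - F n x|) < e.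
  move=> Nn nk; rewrite (_ : (fun x => _) = fun x => F k x - F n x); last first.
    by apply/funext => x; rewrite ger0_norm// subr_ge0 Fmono.
  rewrite (integralB hA nuP); try exact: fnL.
  have := IN n Nn; have := IN k (leq_trans Nn nk).
  rewrite !ltr_norml => /andP[_ h1] /andP[h2 _]; lra.
exists N => n k Nn Nk; have [nk|/ltnW kn] := leqP n k; last exact: wl.
by rewrite integral_distC; exact: wl.
Qed.

End truncation.

(** * The charge induced by a positive functional *)

Section representation.
Variables (R : realType) (Omega : Type).
Implicit Types (f g : Omega -> R).

Lemma set_algebraT : set_algebra (@setT (set Omega)).
Proof. by split. Qed.

Definition bounded_funs : set (Omega -> R) :=
  [set f | exists M, forall x, `|f x| <= M].

Lemma bounded_funs_sublattice : vector_sublattice bounded_funs.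
Proof.
split.
- by exists 0 => x; rewrite normr0.
- move=> a f g [M fM] [N gN]; exists (`|a| * M + N) => x.
  apply: le_trans (ler_normD _ _) _; rewrite lerD//.
  by rewrite normrM ler_wpM2l.
- move=> f g [M fM] [N gN]; exists (Num.max M N) => x.
  by rewrite le_max; case: (leP (f x) (g x)); rewrite ?fM ?gN ?orbT.
- move=> f g [M fM] [N gN]; exists (Num.max M N) => x.
  by rewrite le_max; case: (leP (f x) (g x)); rewrite ?fM ?gN ?orbT.
Qed.

Lemma bounded_funs_cst (c : R) : bounded_funs (fun=> c).
Proof. by exists `|c| => x. Qed.

Lemma bounded_funs_approx f e : bounded_funs f -> 0 < e ->
  exists2 u, simple_fun setT u & forall x, `|f x - u x| <= e.
Proof.
(* Adding M makes f nonnegative, so that [Num.truncn] is the floor; the approximant is f rounded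
   down to a grid of mesh e. *)
move=> [M fM] e0; pose k x := Num.truncn ((f x + M) / e).
have fM0 x : 0 <= f x + M by have := fM x; rewrite ler_norml => /andP[? _]; lra.
pose K := Num.truncn ((M + M) / e).
exists (fun x => e * (k x)%:R - M).
  apply: (simple_fun_comp set_algebraT (t := k) (fun i => e * i%:R - M)
    (r := iota 0 K.+1)) => // x.
  rewrite mem_iota/= add0n ltnS; apply: le_truncn.
  rewrite ler_pM2r ?invr_gt0// lerD2r.
  by have := fM x; rewrite ler_norml => /andP[].
move=> x; have /andP[h1 h2] := truncn_itv (divr_ge0 (fM0 x) (ltW e0)).
move: h1; rewrite -/(k x) ler_pdivlMr// => h1.
move: h2; rewrite -/(k x) ltr_pdivrMr// -addn1 natrD mulrDl mul1r => h2.
by rewrite ler_norml; apply/andP; split; lra.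
Qed.

Section bounded.
Variable q : (Omega -> R) -> R.
Hypothesis qP : positive_linear bounded_funs q.

Definition measure_of (E : set Omega) : R := q (fun x => `[< E x >]%:R).

Let BL := bounded_funs_sublattice.
Let BT : bounded_funs (cst 1) := bounded_funs_cst 1.

Lemma bounded_funs_indic (E : set Omega) : bounded_funs (fun x => `[< E x >]%:R).
Proof. by exists 1 => x; rewrite normr_nat lern1 leq_b1. Qed.

Lemma measure_of_ge0 E : 0 <= measure_of E.
Proof. by apply: (positive_ge0 qP (bounded_funs_indic E)) => x; rewrite ler0n. Qed.

Lemma measure_of_ba_pos : ba_pos setT measure_of.
Proof.
split; last by move=> B _; exact: measure_of_ge0.
split=> [B C _ _ BC0|].
  rewrite -(positiveD qP); try exact: bounded_funs_indic.
  congr q; apply/funext => x; rewrite asbool_or.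
  have : ~ (B `&` C) x by rewrite BC0.
  by case: asboolP => Bx; case: asboolP => Cx nBC; rewrite ?addr0 ?add0r//; case: nBC.
exists (q (cst 1)) => B _; rewrite ger0_norm ?measure_of_ge0// /measure_of.
apply: (positive_le BL qP) => // [|x]; first exact: bounded_funs_indic.
by rewrite lern1 leq_b1.
Qed.

Let mP := measure_of_ba_pos.

Lemma measure_of_simple u : simple_fun setT u -> q u = simple_integral measure_of u.
Proof.
move=> su; have [r [ur ru Ar]] : exists r : seq R, [/\ uniq r, forall x, u x \in r & True].
  case: su => /finite_seqP[r rE] _; exists (undup r); split=> //.
    exact: undup_uniq.
  by move=> x; rewrite mem_undup; have : range u (u x) by []; rewrite rE.
rewrite (simple_integralE set_algebraT (ba_posU mP) ur)//.
transitivity (q (fun x => \sum_(c <- r) c * `[< (u @^-1` [set c]) x >]%:R)).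
  congr q; apply/funext => x; rewrite (bigD1_seq (u x))//= asboolT// mulr1.
  rewrite big1 ?addr0// => c cu; rewrite asboolF ?mulr0//= => cE.
  by rewrite cE eqxx in cu.
elim: r {ur ru Ar} => [|c r IH].
  by rewrite big_nil -[RHS](positive0 BL BT qP); congr q; apply/funext => x; rewrite big_nil.
have Br : bounded_funs (fun x => \sum_(c <- r) c * `[< (u @^-1` [set c]) x >]%:R).
  elim: r {IH} => [|d r IH].
    by under eq_fun do rewrite big_nil; exact: bounded_funs_cst.
  under eq_fun do rewrite big_cons.
  by apply: (lattice_lin BL) => //; exact: bounded_funs_indic.
under eq_fun do rewrite big_cons.
rewrite big_cons -IH (positive_linearE qP)//; exact: bounded_funs_indic.
Qed.

(** Both q and the integral are continuous for the supremum norm, by positivity and finite total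
    mass, and they agree on simple functions, which are uniformly dense. *)
Lemma measure_of_bounded f : bounded_funs f ->
  integrable_fa setT measure_of f /\ integral_fa setT measure_of f = q f.
Proof.
move=> Bf; have sT := set_algebraT.
have mT0 : 0 <= measure_of setT by exact: measure_of_ge0.
have /choice[u uP] : forall n, exists u, simple_fun setT u /\
    forall x, `|f x - u x| <= n.+1%:R^-1.
  move=> n; have [|v sv fv] := @bounded_funs_approx f n.+1%:R^-1 Bf.
    by rewrite invr_gt0 ltr0Sn.
  by exists v.
have uL n : integrable_fa setT measure_of (u n).
  by apply: integrable_simple => //; case: (uP n).
have close e : 0 < e -> exists N, forall n, (N <= n)%N -> forall x, `|f x - u n x| <= e.
  move=> e0; have [N uN] := eventually_small 1 e0; exists N => n /uN.
  by rewrite mul1r => /ltW ne x; apply: le_trans ne; case: (uP n).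
have d0 e : 0 < e -> 0 < e / (measure_of setT + 1) / 2.
  by move=> e0; rewrite !divr_gt0// ltr_wpDl.
have dlt e : 0 < e -> e / (measure_of setT + 1) * measure_of setT < e.
  by move=> e0; rewrite mulrAC ltr_pdivrMr ?ltr_wpDl// ltr_pM2l// ltrDl.
have [||fL uf] := integrable_closed sT mP uL (f := f).
- move=> e d e0 d1; have [N uN] := close e e0; exists N => n Nn.
  apply: le_lt_trans d1; rewrite -(ba_pos0 sT mP); apply: (outer_le sT mP) => // x /=.
  by rewrite ltNge distrC uN.
- move=> e e0; have [N uN] := close _ (d0 _ e0); exists N => n k Nn Nk.
  apply: le_lt_trans (dlt _ e0); rewrite -(integral_cst sT mP).
  apply: (integral_le sT mP); [exact: integrable_dist|exact: integrable_cst|move=> x].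
  apply: le_trans (ler_distD (f x) _ _) _; rewrite [leRHS]splitr distrC.
  by rewrite lerD// uN.
split=> //; apply/eqP; rewrite -subr_eq0 -normr_le0; apply/ler_addgt0Pr => e e0.
rewrite add0r; have [N uN] := close _ (d0 _ e0).
have e2 : 0 < e / 2 by rewrite divr_gt0.
have [sN _] := uP N; rewrite -(subrKA (integral_fa setT measure_of (u N))).
apply: le_trans (ler_normD _ _) _; rewrite [leRHS]splitr; apply: lerD.
  apply: le_trans (integral_dist sT mP fL (uL N)) _.
  apply: le_trans (ltW (dlt _ e2)); rewrite -(integral_cst sT mP).
  apply: (integral_le sT mP); [exact: integrable_dist|exact: integrable_cst|move=> x].
  by apply: le_trans (uN N (leqnn _) x) _; rewrite mulrAC.
have Bu : bounded_funs (u N).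
  by have [M _ uM] := simple_fun_bounded sN; exists M.
rewrite (integral_simple sT mP)// -measure_of_simple//.
rewrite distrC -(positiveB qP)//.
have Bd := latticeB BL Bf Bu.
apply: le_trans (positive_norm BL BT qP Bd) _.
have q1 : measure_of setT = q (cst 1).
  by congr q; apply/funext => x; rewrite asboolT.
apply: le_trans (ltW (dlt _ e2)); rewrite q1 -(positive_cst BL BT qP).
apply: (positive_le BL qP); [exact: lattice_norm|exact: bounded_funs_cst|move=> x].
by apply: le_trans (uN N (leqnn _) x) _; rewrite -q1 mulrAC.
Qed.

End bounded.

(** For f >= 0 in L the truncations min(f, n) are bounded and lie in L, so their integrals are
    values of phi and stay below phi f; this makes f integrable. For unbounded f only an inequality
    survives, and its defect is the source of the singular part. *)
Lemma representation (L : set (Omega -> R)) (phi : (Omega -> R) -> R) :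
  vector_sublattice L -> L (cst 1) -> positive_linear L phi ->
  exists m : set Omega -> R, [/\ ba_pos setT m, L `<=` integrable_fa setT m,
    forall f, L f -> bounded_funs f -> integral_fa setT m f = phi f &
    forall f, L f -> (forall x, 0 <= f x) -> integral_fa setT m f <= phi f].
Proof.
move=> hL LT phiP; have [q /= [[qlin q0] qphi]] := positive_extension hL LT phiP.
have sT := set_algebraT.
have BD f : bounded_funs f -> exists2 h, L h & forall x, `|f x| <= h x.
  by move=> [M fM]; exists (fun=> M) => //; exact: lattice_cst.
have qP : positive_linear bounded_funs q.
  split=> [a f g /BD Bf /BD Bg|f /BD Bf f0]; [exact: qlin|exact: q0].
have mP := measure_of_ba_pos qP; have mB := measure_of_bounded qP.
exists (measure_of q).
have trunc f n : L f -> (forall x, 0 <= f x) -> L (fun x => Num.min (f x) n%:R) /\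
    bounded_funs (fun x => Num.min (f x) n%:R).
  move=> Lf f0; split; first by apply: (lattice_min hL) => //; exact: lattice_cst.
  exists n%:R => x; rewrite ger0_norm; first by rewrite ge_min lexx orbT.
  by rewrite le_min f0 ler0n.
have posL f : L f -> (forall x, 0 <= f x) ->
    integrable_fa setT (measure_of q) f /\
    integral_fa setT (measure_of q) f <= phi f.
  move=> Lf f0.
  have tL n : integrable_fa setT (measure_of q) (fun x => Num.min (f x) n%:R).
    by have [_ /mB[]] := trunc f n Lf f0.
  have tphi n : integral_fa setT (measure_of q) (fun x => Num.min (f x) n%:R) <= phi f.
    have [Lt /mB[_ ->]] := trunc f n Lf f0; rewrite qphi//.
    by apply: (positive_le hL phiP) => // x; rewrite ge_min lexx.
  have fL := integrable_of_min sT mP f0 tL tphi; split=> //.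
  have cv := integral_min_cvg sT mP fL tL; rewrite -(cvg_lim _ cv)//.
  apply: limr_le; last by apply: nearW => n; exact: tphi.
  by apply/cvg_ex; eexists; exact: cv.
split=> //.
- move=> f Lf; rewrite (_ : f = fun x => Num.max (f x) 0 - Num.max (-1 * f x) 0).
    have L0 := lattice_cst hL LT 0.
    apply: integrableB => //; apply posL => [|x]; rewrite ?le_max ?lexx ?orbT//.
      exact: lattice_max.
    by apply: lattice_max => //; exact: latticeZ.
  by apply/funext => x; rewrite mulN1r; case: leP => ?; case: leP => ?; lra.
- by move=> f Lf Bf; have [_ ->] := mB f Bf; exact: qphi.
- by move=> f Lf f0; case: (posL f Lf f0).
Qed.

End representation.

(** * Order convergence and monotone extensions *)

Section series.
Variables (R : realType) (Omega : Type) (A : set (set Omega)).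
Variable nu : set Omega -> R.
Hypotheses (hA : set_algebra A) (nuP : ba_pos A nu).

Local Notation ov := (outer_variation A nu).
Local Notation I := (integral_fa A nu).
Local Notation L1 := (integrable_fa A nu).

Lemma half_exp_le_inv n : 2^-1 ^+ n <= n.+1%:R^-1 :> R.
Proof.
rewrite exprVn lef_pV2 ?posrE ?ltr0Sn ?exprn_gt0//.
by rewrite -natrX ler_nat ltn_expl.
Qed.

Lemma half_exp_small (C d : R) : 0 <= C -> 0 < d ->
  exists N, forall n, (N <= n)%N -> C * 2^-1 ^+ n < d.
Proof.
move=> C0 d0; have [N CN] := eventually_small C d0; exists N => n /CN.
by apply: le_lt_trans; exact/ler_wpM2l/half_exp_le_inv.
Qed.

Variables (z : nat -> Omega -> R).
Hypothesis zL : forall n, L1 (z n).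
Hypothesis z0 : forall n x, 0 <= z n x.
Hypothesis zI : forall n, I (z n) <= 2^-1 ^+ n.

Lemma integral_partial_sum K i :
  L1 (fun x => \sum_(K <= n < K + i) z n x) /\
  I (fun x => \sum_(K <= n < K + i) z n x) <= 2 * 2^-1 ^+ K - 2 * 2^-1 ^+ (K + i).
Proof.
elim: i => [|i [IL IE]].
  rewrite addn0 (_ : (fun _ => _) = fun=> 0); last first.
    by apply/funext => x; rewrite big_geq.
  by split; [exact: integrable_cst|rewrite (integral_cst hA nuP) mul0r subrr].
rewrite addnS (_ : (fun _ => _) =
    fun x => \sum_(K <= n < K + i) z n x + z (K + i)%N x); last first.
  by apply/funext => x; rewrite big_nat_recr ?leq_addr.
split; first exact: integrableD.
rewrite (integralD hA nuP)//; have := zI (K + i); rewrite exprS; lra.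
Qed.

(** The series may diverge at some points, where g is arbitrary: g has to equal the late partial
    sums only off sets of small outer measure. This replaces countable additivity; the geometric
    bound makes the partial sums Cauchy in mean. *)
Lemma integrable_series K (g : Omega -> R) :
  (forall d : R, 0 < d -> exists N, forall J, (N <= J)%N ->
    ov [set x | g x <> \sum_(K <= n < J) z n x] < d) ->
  L1 g /\ I g <= 2 * 2^-1 ^+ K.
Proof.
move=> gz; pose P J x := \sum_(K <= n < J) z n x.
pose F i := P (K + i)%N.
have FL i : L1 (F i) by case: (integral_partial_sum K i).
have FI i : I (F i) <= 2 * 2^-1 ^+ K.
  have [_ /le_trans] := integral_partial_sum K i; apply.
  by rewrite lerBlDr lerDl mulr_ge0// exprn_ge0.
have two0 : 0 <= 2 :> R by [].
have Fdist i j : (i <= j)%N -> I (fun x => `|F j x - F i x|) <= 2 * 2^-1 ^+ (K + i).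
  move=> ij; rewrite (_ : (fun _ => _) =
      fun x => \sum_(K + i <= n < (K + i) + (j - i)) z n x); last first.
    apply/funext => x; rewrite /F /P -addnA subnKC//.
    rewrite (@big_cat_nat _ _ _ (K + i) K (K + j)) ?leq_addr ?leq_add2l//=.
    by rewrite addrAC subrr add0r ger0_norm// sumr_ge0.
  have [_ /le_trans] := integral_partial_sum (K + i) (j - i); apply.
  by rewrite lerBlDr lerDl mulr_ge0// exprn_ge0.
have half_le i : 2^-1 ^+ (K + i) <= 2^-1 ^+ i :> R.
  by rewrite exprD ler_piMl ?exprn_ge0// exprn_ile1// invf_le1 ?ler1n.
have [||gL Fg] := integrable_closed hA nuP FL (f := g).
- move=> e d e0 d0; have [N gN] := gz d d0; exists N => i Ni.
  apply: le_lt_trans (gN (K + i)%N _); last exact: leq_trans (leq_addl _ _).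
  apply: (le_outer hA nuP) => x /= ex gx; move: ex.
  by rewrite gx subrr normr0 ltNge ltW.
- move=> e e0; have [N HN] := half_exp_small two0 e0; exists N => i j Ni Nj.
  have small k : (N <= k)%N -> 2 * 2^-1 ^+ (K + k) < e.
    by move=> /HN; apply: le_lt_trans; rewrite ler_wpM2l.
  have [ij|/ltnW ji] := leqP i j; last exact: le_lt_trans (Fdist _ _ ji) (small _ Nj).
  by rewrite integral_distC; exact: le_lt_trans (Fdist _ _ ij) (small _ Ni).
split=> //; apply/ler_addgt0Pr => e e0; have [N FN] := Fg e e0.
have := integral_dist hA nuP (FL N) gL => /le_lt_trans /(_ (FN N (leqnn _))).
by rewrite ltr_norml => /andP[]; have := FI N; lra.
Qed.

End series.

(** * Order convergence for a nonnegative charge *)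

Section order_convergence.
Variables (R : realType) (Omega : Type) (A : set (set Omega)).
Variable nu : set Omega -> R.
Hypotheses (hA : set_algebra A) (nuP : ba_pos A nu).
Implicit Types (f g : Omega -> R) (F G : nat -> Omega -> R).

Local Notation ov := (outer_variation A nu).
Local Notation I := (integral_fa A nu).
Local Notation L1 := (integrable_fa A nu).

Definition dominating (B : nat -> Omega -> R) :=
  [/\ forall n, L1 (B n) /\ forall x, 0 <= B n x,
      forall n x, B n.+1 x <= B n x &
      forall e : R, 0 < e -> exists N, forall n, (N <= n)%N -> I (B n) < e].

Definition order_cvg F f := (forall n, L1 (F n)) /\
  exists2 B, dominating B & forall n x, `|F n x - f x| <= B n x.

Lemma dominating_mono B n k x : dominating B -> (n <= k)%N -> B k x <= B n x.
Proof.
move=> [_ Bd _]; elim: k => [|k IH]; first by rewrite leqn0 => /eqP ->.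
by rewrite leq_eqVlt => /orP[/eqP -> //|/IH]; exact: le_trans.
Qed.

Lemma dominatingD B C : dominating B -> dominating C ->
  dominating (fun n x => B n x + C n x).
Proof.
move=> [B0 Bd Bs] [C0 Cd Cs]; split=> [n|n x|e e0].
- have [BL Bp] := B0 n; have [CL Cp] := C0 n.
  by split=> [|x]; [exact: integrableD|exact: addr_ge0].
- exact: lerD.
- have e2 : 0 < e / 2 by rewrite divr_gt0.
  have [N BN] := Bs _ e2; have [N' CN'] := Cs _ e2.
  exists (maxn N N') => n; rewrite geq_max => /andP[Nn Nn'].
  have [BL _] := B0 n; have [CL _] := C0 n.
  rewrite (integralD hA nuP)// [ltRHS]splitr.
  exact: ltrD (BN _ Nn) (CN' _ Nn').
Qed.

Lemma dominating_null f : (forall x, 0 <= f x) -> L1 f -> I f = 0 ->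
  dominating (fun=> f).
Proof. by move=> f0 fL If; split=> // e e0; exists 0%N => n _; rewrite If. Qed.

Lemma dominating0 : dominating (fun _ _ => 0).
Proof.
by apply: dominating_null => //; [exact: integrable_cst|rewrite (integral_cst hA nuP) mul0r].
Qed.

Lemma dominating_excess f : L1 f -> dominating (fun n => excess n%:R f).
Proof.
move=> fL; split=> [n|n x|e e0].
- by split; [exact: integrable_excess|exact: excess_ge0].
- rewrite /excess ge_max excess_ge0 andbT le_max lerB// ?orTb//.
  by rewrite ler_nat.
- have [M M0 fM] := integral_excess_small hA nuP fL e0.
  exists (Num.bound M) => n Mn; apply: fM; apply: ltW.
  by apply: lt_le_trans (archi_boundP M0) _; rewrite ler_nat.
Qed.

Lemma order_cvg_cst f : L1 f -> order_cvg (fun=> f) f.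
Proof.
move=> fL; split=> //; exists (fun _ _ => 0); first exact: dominating0.
by move=> n x; rewrite subrr normr0.
Qed.

Lemma order_cvg_excess f : L1 f -> order_cvg (fun n => excess n%:R f) (fun=> 0).
Proof.
move=> fL; split; first by move=> n; exact: integrable_excess.
exists (fun n => excess n%:R f); first exact: dominating_excess.
by move=> n x; rewrite subr0 ger0_norm// excess_ge0.
Qed.

End order_convergence.

(** * From a monotone extension to order continuity *)

Section monotone_extension.
Variables (R : realType) (Omega : Type) (A : set (set Omega)).
Variable nu : set Omega -> R.
Hypotheses (hA : set_algebra A) (nuP : ba_pos A nu).
Variables (L : set (Omega -> R)) (phi : (Omega -> R) -> R).
Hypotheses (hL : vector_sublattice L) (LT : L (cst 1)).
Hypothesis phiP : positive_linear L phi.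

Local Notation ov := (outer_variation A nu).
Local Notation I := (integral_fa A nu).
Local Notation L1 := (integrable_fa A nu).

Hypothesis LI : L `<=` L1.

Definition lattice_order_limits := [set f | exists2 F : nat -> Omega -> R,
  forall n, L (F n) & order_cvg A nu F f].

Variable phis : (Omega -> R) -> R.
Hypothesis phis_ext : forall f, L f -> phis f = phi f.
Hypothesis phis_le : forall f g, lattice_order_limits f ->
  lattice_order_limits g -> ov [set x | g x < f x] = 0 -> phis f <= phis g.

Lemma order_limits_lattice f : L f -> lattice_order_limits f.
Proof. by move=> Lf; exists (fun=> f) => //; exact/order_cvg_cst/LI. Qed.

Lemma lattice_sum (r : seq nat) (w : nat -> Omega -> R) : (forall n, L (w n)) ->
  L (fun x => \sum_(n <- r) w n x).
Proof.
move=> Lw; elim: r => [|n r IH].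
  by under eq_fun do rewrite big_nil; exact: (lattice_cst hL LT).
by under eq_fun do rewrite big_cons; exact: (latticeD hL).
Qed.

Lemma lattice_bigmax (r : seq nat) (w : nat -> Omega -> R) : (forall n, L (w n)) ->
  L (fun x => \big[Num.max/0]_(n <- r) w n x).
Proof.
move=> Lw; elim: r => [|n r IH].
  by under eq_fun do rewrite big_nil; exact: (lattice_cst hL LT).
by under eq_fun do rewrite big_cons; exact: (lattice_max hL).
Qed.

Lemma sum_nat_eq0_tail (F : nat -> R) K m J :
  (forall n, (m <= n)%N -> F n = 0) -> (m <= J)%N ->
  \sum_(K <= n < J) F n = \sum_(K <= n < m) F n.
Proof.
move=> F0 mJ; have [Km|mK] := leqP K m.
  rewrite (@big_cat_nat _ _ _ m)//= [X in _ + X]big_nat_cond [X in _ + X]big1 ?addr0//.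
  by move=> n /andP[/andP[mn _] _]; exact: F0.
rewrite [RHS]big_geq ?(ltnW mK)// big_nat_cond big1// => n /andP[/andP[Kn _] _].
exact/F0/(leq_trans _ Kn)/ltnW.
Qed.

Section decreasing.
Variable w : nat -> Omega -> R.
Hypothesis wL : forall n, L (w n).
Hypothesis w0 : forall n x, 0 <= w n x.
Hypothesis w_decr : forall n x, w n.+1 x <= w n x.
Hypothesis wI : forall n, I (w n) <= 2^-1 ^+ n * 2^-1 ^+ n * 2^-1 ^+ n.
Variable c : R.
Hypothesis c0 : 0 < c.

(** [v] cuts at half the level of [u]: it is at least c/2 wherever w_n > c, which lets the
    correction in [F] overcome the partial sum there, yet it vanishes once w_n <= c/2. [z] majorizes
    the terms of the series together with the correction. [N] is the set where no v_n vanishes. *)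
Let u n := excess c (w n).
Let v n := excess (c / 2) (w n).
Let S K x := \sum_(0 <= n < K) 2 ^+ n * u n x.
Let F K x := Num.max (S K x - K%:R * 2 ^+ K * v K x) 0.
Let z n x := (2 ^+ n + n%:R * 2 ^+ n) * v n x.
Let N := [set x | forall n, c / 2 < w n x].

Let w_mono n k x : (n <= k)%N -> w k x <= w n x.
Proof.
elim: k => [|k IH]; first by rewrite leqn0 => /eqP ->.
by rewrite leq_eqVlt => /orP[/eqP -> //|/IH]; exact: le_trans.
Qed.

Let u0 n x : 0 <= u n x. Proof. exact: excess_ge0. Qed.

Let v0 n x : 0 <= v n x. Proof. exact: excess_ge0. Qed.

Let uv n x : u n x <= v n x.
Proof.
by rewrite /u /v /excess ge_max v0 andbT le_max lerB// ?orTb// ler_pdivrMr// ler_pMr// ler1n.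
Qed.

Let vw n x : v n x <= w n x.
Proof. by rewrite /v /excess ge_max w0 andbT gerBl divr_ge0// ltW. Qed.

Let u_eq0 n x : w n x <= c -> u n x = 0.
Proof. by move=> wc; rewrite /u /excess max_r// subr_le0. Qed.

Let v_eq0 n x : w n x <= c / 2 -> v n x = 0.
Proof. by move=> wc; rewrite /v /excess max_r// subr_le0. Qed.

Let half_c : c / 2 <= c. Proof. by rewrite ler_pdivrMr// ler_pMr// ler1n. Qed.

Let pow0 n : 0 <= 2 ^+ n :> R. Proof. exact: exprn_ge0. Qed.

Let FL K : L (F K).
Proof.
apply: (lattice_max hL); last exact: (lattice_cst hL LT).
apply: (latticeB hL).
  by apply: lattice_sum => n; exact/(latticeZ hL LT)/(lattice_excess hL LT).
exact/(latticeZ hL LT)/(lattice_excess hL LT).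
Qed.

Let F0 K x : 0 <= F K x. Proof. by rewrite /F le_max lexx orbT. Qed.

Let S_mono K J x : (K <= J)%N -> S K x <= S J x.
Proof.
move=> KJ; rewrite /S (@big_cat_nat _ _ _ K 0 J)//= lerDl.
by apply: sumr_ge0 => n _; rewrite mulr_ge0.
Qed.

Let S0 K x : 0 <= S K x.
Proof. by apply: sumr_ge0 => n _; rewrite mulr_ge0. Qed.

Let FS K x : F K x <= S K x.
Proof. by rewrite /F ge_max S0 andbT gerBl !mulr_ge0. Qed.

Let S_stat m K x : w m x <= c -> (m <= K)%N -> S K x = S m x.
Proof.
move=> wm mK; apply: sum_nat_eq0_tail => // n mn.
by rewrite u_eq0 ?mulr0// (le_trans (w_mono x mn)).
Qed.

(* Where some w_n drops below c the sums S_K are eventually constant; elsewhere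
   v_K >= c / 2, and the correction term swallows S_K <= 2^K w_0. *)
Let F_bounded x : exists C, forall K, F K x <= C.
Proof.
have [[m wm]|nw] := pselect (exists m, w m x <= c).
  exists (S m x) => K; apply: le_trans (FS K x) _.
  have [mK|/ltnW Km] := leqP m K; first by rewrite (S_stat wm mK).
  exact: S_mono.
have cw n : c < w n x by rewrite ltNge; apply/negP => wc; apply: nw; exists n.
have SK K : S K x <= 2 ^+ K * w 0%N x.
  elim: K => [|K IH]; first by rewrite /S big_geq// expr0 mul1r.
  rewrite /S big_nat_recr//= exprS.
  have : 2 ^+ K * u K x <= 2 ^+ K * w 0%N x.
    by rewrite ler_wpM2l// (le_trans (uv _ _))// (le_trans (vw _ _))// w_mono.
  by move: IH; rewrite /S -mulrA mulr_natl mulr2n; exact: lerD.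
pose K0 := Num.bound (w 0%N x / (c / 2)).
exists (2 ^+ K0 * w 0%N x) => K; have [KK0|K0K] := leqP K K0.
  apply: le_trans (FS _ _) _; apply: le_trans (SK _) _.
  by rewrite ler_wpM2r// ler_eXn2l// ltr1n.
rewrite /F ge_max; apply/andP; split; last by rewrite mulr_ge0.
apply: (@le_trans _ _ 0); last by rewrite mulr_ge0.
rewrite subr_le0; apply: le_trans (SK _) _.
rewrite [K%:R * _]mulrC -mulrA ler_wpM2l//.
apply: (@le_trans _ _ (K%:R * (c / 2))).
  rewrite -ler_pdivrMr ?divr_gt0//; apply: ltW.
  have := archi_boundP (divr_ge0 (w0 0%N x) (ltW (divr_gt0 c0 (ltr0Sn _ 1)))).
  by move=> /lt_le_trans; apply; rewrite ler_nat ltnW.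
rewrite ler_wpM2l// /v /excess le_max; apply/orP; left.
by have := cw K; lra.
Qed.

Let Nnull J : ov [set x | c / 2 < w J x] <= 4 / c * 2^-1 ^+ J.
Proof.
have c2 : 0 < c / 2 by rewrite divr_gt0.
have wE : (fun x => `|w J x|) = w J by apply/funext => x; rewrite ger0_norm.
have := chebyshev_outer hA nuP (LI (wL J)) c2; rewrite wE.
rewrite (_ : [set x | c / 2 < `|w J x|] = [set x | c / 2 < w J x]); last first.
  by apply/predeqP => x /=; rewrite ger0_norm.
move=> /le_trans; apply.
rewrite invf_div mulrA -natrM; apply: ler_wpM2l; first by rewrite divr_ge0// ltW.
apply: le_trans (wI J) _; rewrite -mulrA ler_piMr ?exprn_ge0//.
by rewrite mulr_ile1 ?exprn_ge0// exprn_ile1// invf_le1 ?ler1n.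
Qed.

Let ovN : ov N = 0.
Proof.
apply/eqP; rewrite eq_le outer_ge0// andbT; apply/ler_addgt0Pr => e e0.
rewrite add0r; have C0 : 0 <= 4 / c by rewrite divr_ge0// ltW.
have [J eJ] := half_exp_small C0 e0; apply: le_trans (ltW (eJ J (leqnn _))).
by apply: le_trans (Nnull J); apply: (le_outer hA nuP) => x; exact.
Qed.

Let zL n : L1 (z n).
Proof. exact/(integrableZ hA nuP)/(integrable_excess hA nuP)/LI. Qed.

Let z0 n x : 0 <= z n x.
Proof. by rewrite mulr_ge0// addr_ge0// mulr_ge0. Qed.

Let zI n : I (z n) <= 2^-1 ^+ n.
Proof.
have vL : L1 (v n) by exact/(integrable_excess hA nuP)/LI.
rewrite (integralZ hA nuP)//.
have Iv : I (v n) <= 2^-1 ^+ n * 2^-1 ^+ n * 2^-1 ^+ n.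
  by apply: le_trans (wI n); apply: (integral_le hA nuP) => //; exact: LI.
have Iv0 : 0 <= I (v n) by exact: (integral_ge0 hA nuP).
(* This is 1 + n <= 2^n, multiplied by 2^n. *)
have h : 2 ^+ n + n%:R * 2 ^+ n <= 2 ^+ n * 2 ^+ n :> R.
  rewrite -[X in X + _]mul1r -mulrDl ler_wpM2r// -natrX -(natrD _ 1) ler_nat.
  by rewrite add1n ltn_expl.
apply: le_trans (ler_wpM2r Iv0 h) _.
apply: le_trans (ler_wpM2l _ Iv) _; first by rewrite mulr_ge0.
rewrite -!exprMn (_ : 2 * 2 * _ = 2^-1)//.
by rewrite mulrA -[2 * 2 * _ * _]mulrA -!mulrA; field.
Qed.

(** Off [N] the u_n and v_n vanish from the index m x on, so f and the tails of the z_n are finite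
    sums. On [N] the dominating function is a pointwise bound of all the F_K, constant in K; as [N]
    is null, this changes no integral. *)
Lemma unbounded_order_limit : exists2 f, lattice_order_limits f &
  forall n, ov [set x | f x < 2 ^+ n * u n x] = 0.
Proof.
have /choice[m mP] : forall x, exists m, ~ N x -> w m x <= c / 2.
  move=> x; have [Nx|/existsNP[m wm]] := pselect (N x); first by exists 0%N.
  by exists m => _; rewrite leNgt; apply/negP.
have /choice[E EP] := F_bounded.
pose f x := if `[< N x >] then 0 else S (m x) x.
pose B K x := if `[< N x >] then E x else \sum_(K <= n < m x) z n x.
have v_tail x n : ~ N x -> (m x <= n)%N -> v n x = 0.
  by move=> /mP wm mn; rewrite v_eq0// (le_trans (w_mono x mn)).
have S_m x K : ~ N x -> (m x <= K)%N -> S K x = S (m x) x.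
  by move=> /mP wm mK; apply: S_stat => //; exact: le_trans half_c.
have BL K : L1 (B K) /\ I (B K) <= 2 * 2^-1 ^+ K.
  apply: (integrable_series hA nuP zL z0 zI) => d d0.
  have C0 : 0 <= 4 / c by rewrite divr_ge0// ltW.
  have [J0 eJ] := half_exp_small C0 d0; exists J0 => J J0J.
  apply: le_lt_trans (eJ J J0J); apply: le_trans (Nnull J).
  apply: (le_outer hA nuP) => x /=; apply: contra_notT; rewrite -leNgt => wJ.
  have nN : ~ N x by move=> /(_ J); rewrite ltNge wJ.
  rewrite /B asboolF//.
  have z_tail i : w i x <= c / 2 -> forall n, (i <= n)%N -> z n x = 0.
    by move=> wi n ni; rewrite /z v_eq0 ?mulr0// (le_trans (w_mono x ni)).
  (* m x need not be the first index where w is at most c/2, so J may fall on either side of it. *)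
  have [mJ|/ltnW Jm] := leqP (m x) J.
    by rewrite [RHS](@sum_nat_eq0_tail _ _ (m x))//; exact/z_tail/mP.
  by rewrite (@sum_nat_eq0_tail _ _ J)//; exact: z_tail.
exists f; last first.
  move=> n; apply/eqP; rewrite eq_le outer_ge0// andbT -ovN.
  apply: (le_outer hA nuP) => x /=; apply: contraPP => nN.
  rewrite /f asboolF//; apply/negP; rewrite -leNgt.
  have [mn|nm] := leqP (m x) n.
    rewrite u_eq0 ?mulr0//; apply: le_trans half_c.
    exact: le_trans (w_mono x mn) (mP x nN).
  apply: le_trans (S_mono x nm).
  by rewrite /S big_nat_recr//= lerDr; exact: S0.
exists F; first exact: FL.
split=> [n|]; first exact: LI.
exists B.
- split=> [n|n x|e e0].
  + have [BLn _] := BL n; split=> // x; rewrite /B; case: asboolP => // _.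
      exact: le_trans (EP x 0%N).
    exact: sumr_ge0.
  + rewrite /B; case: asboolP => // _; have [nm|mn] := ltnP n (m x).
      by rewrite [leRHS]big_ltn// lerDr.
    by rewrite !big_geq// ltnW.
  + have [J eJ] := half_exp_small (ler0n R 2) e0; exists J => n /eJ.
    by apply: le_lt_trans; case: (BL n).
- move=> K x; rewrite /f /B; case: asboolP => [Nx|nN].
    by rewrite subr0 ger0_norm.
  have [mK|Km] := leqP (m x) K.
    rewrite /F v_tail// mulr0 subr0 S_m// max_l// subrr normr0.
    exact: sumr_ge0.
  have FK : S K x - K%:R * 2 ^+ K * v K x <= F K x by rewrite /F le_max lexx.
  have SE : S (m x) x = S K x + \sum_(K <= n < m x) 2 ^+ n * u n x.
    by rewrite /S (@big_cat_nat _ _ _ K)// ltnW.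
  have T0 : 0 <= \sum_(K <= n < m x) 2 ^+ n * u n x.
    by apply: sumr_ge0 => n _; rewrite mulr_ge0.
  (* The gap between f and F_K is at most the tail of the series plus the correction at K; z_K
     absorbs that correction along with its own term. *)
  have T1 : \sum_(K <= n < m x) 2 ^+ n * u n x + K%:R * 2 ^+ K * v K x <=
      \sum_(K <= n < m x) z n x.
    rewrite !(big_ltn Km) addrAC; apply: lerD.
      by rewrite /z mulrDl lerD2r ler_wpM2l.
    apply: ler_sum => n _; rewrite /z mulrDl.
    by rewrite ler_wpDr ?ler_wpM2l// !mulr_ge0.
  rewrite SE ler_norml; have := FS K x; move=> FSK; apply/andP; split; lra.
Qed.

Lemma decreasing_contra e : 0 < e -> (forall n, e <= phi (u n)) -> False.
Proof.
move=> e0 eu; have [f fl fu] := unbounded_order_limit.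
have h n : 2 ^+ n * e <= phis f.
  have Lu : L (u n) by exact: (lattice_excess hL LT).
  have L2 : L (fun x => 2 ^+ n * u n x) by exact: (latticeZ hL LT).
  apply: le_trans (phis_le (order_limits_lattice L2) fl (fu n)).
  by rewrite phis_ext// (positiveZ hL LT phiP)// ler_wpM2l.
have f0 : 0 <= phis f / e.
  by rewrite divr_ge0// ?ltW//; apply: lt_le_trans (h 0%N); rewrite mul1r.
have := archi_boundP f0; apply/negP; rewrite -leNgt.
rewrite ler_pdivlMr//; apply: le_trans (h (Num.bound (phis f / e))).
apply: ler_wpM2r; first exact: ltW.
by rewrite -natrX ler_nat ltnW// ltn_expl.
Qed.

End decreasing.

Section decreasing_minorant.
Variables (g B : nat -> Omega -> R) (e : R).
Hypotheses (gL : forall n, L (g n)) (g0 : forall n x, 0 <= g n x).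
Hypotheses (Bdom : dominating A nu B) (gB : forall n x, g n x <= B n x).
Hypotheses (e0 : 0 < e) (eg : forall n, e <= phi (g n)).

Let T k M x := \big[Num.max/0]_(k <= j < M) g j x.

Let TL k M : L (T k M). Proof. exact: lattice_bigmax. Qed.

Let T0 k M x : 0 <= T k M x. Proof. exact: bigmax_ge_id. Qed.

Let le_T k M k' M' x : (k' <= k)%N -> (M <= M')%N -> T k M x <= T k' M' x.
Proof. exact: le_bigmax_nat. Qed.

Let gT j k M x : (k <= j < M)%N -> g j x <= T k M x.
Proof. by move=> jk; apply: le_bigmax_seq; rewrite ?mem_index_iota. Qed.

Let TB k M x : T k M x <= B k x.
Proof.
have [B0 _ _] := Bdom; rewrite /T big_nat_cond; apply: bigmax_le.
  by case: (B0 k).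
move=> j /andP[/andP[kj _] _]; apply: le_trans (gB _ _) _.
exact: (dominating_mono _ Bdom).
Qed.

(** The supremum G of all g_j is an order limit of the maxima T 0 M, because the g_j with j >= M lie
    below B_M. Monotonicity of the extension then bounds phi of every maximum by its value at G. *)
Let T_bounded : exists C, forall k M, phi (T k M) <= C.
Proof.
pose G x := sup [set g j x | j in [set: nat]].
have Gne x : [set g j x | j in [set: nat]] !=set0 by exists (g 0%N x), 0%N.
have gB0 j x : g j x <= B 0%N x.
  by apply: le_trans (gB _ _) _; exact: (dominating_mono _ Bdom).
have gG j x : g j x <= G x.
  by apply: ub_le_sup; [exists (B 0%N x) => _ [i _ <-]|exists j].
have TG M x : T 0 M x <= G x.
  by apply: bigmax_le => //; exact: le_trans (g0 0%N x) (gG 0%N x).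
have GT M x : G x <= T 0 M x + B M x.
  apply: ge_sup => // _ [j _ <-]; have [Mj|jM] := leqP M j.
    rewrite -[leLHS]add0r lerD//; apply: le_trans (gB _ _) _.
    exact: (dominating_mono _ Bdom).
  rewrite -[leLHS]addr0 lerD//; first exact: gT.
  by have [B0 _ _] := Bdom; case: (B0 M).
have lG : lattice_order_limits G.
  exists (T 0%N); first exact: TL.
  split=> [n|]; first exact: LI.
  exists B => // n x; rewrite distrC ger0_norm ?subr_ge0//.
  by rewrite lerBlDl.
exists (phis G) => k M; apply: (@le_trans _ _ (phi (T 0 M))).
  by apply: (positive_le hL phiP) => // x; exact: le_T.
rewrite -phis_ext//; apply: phis_le => //; first exact: order_limits_lattice.
rewrite (_ : [set x | _] = set0); last first.
  by rewrite predeqE => x; split=> //=; rewrite ltNge TG.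
apply/eqP; rewrite eq_le outer_ge0// andbT -(ba_pos0 hA nuP).
by apply: (outer_le hA nuP) => //; exact: algebra0.
Qed.

(** The tolerances e/2 * 2^-(k+1) sum to e/2, so half of the lower bound e will survive. *)
Let T_choice : exists Mk : nat -> nat, forall k M,
  phi (T k M) <= phi (T k (Mk k)) + e / 2 * 2^-1 ^+ k.+1.
Proof.
have [C TC] := T_bounded.
suff /choice[Mk MkP] : forall k, exists M', forall M,
    phi (T k M) <= phi (T k M') + e / 2 * 2^-1 ^+ k.+1 by exists Mk.
move=> k; have ek : 0 < e / 2 * 2^-1 ^+ k.+1 :> R.
  by rewrite mulr_gt0 ?divr_gt0// exprn_gt0// invr_gt0.
have Tne : [set phi (T k M) | M in [set: nat]] !=set0 by exists (phi (T k 0)), 0%N.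
have Tub : has_ubound [set phi (T k M) | M in [set: nat]].
  by exists C => _ [M _ <-].
have [_ [M' _ <-] M'P] := sup_adherent ek (conj Tne Tub).
exists M' => M; rewrite -lerBlDr; apply: le_trans (ltW M'P).
by rewrite lerD2r; apply: ub_le_sup => //; exists M.
Qed.

(* Taking the maxima T n M nearly optimal for phi makes their running minima
   lose at most the sum of the errors. *)
Lemma decreasing_minorant : exists w : nat -> Omega -> R,
  [/\ forall n, L (w n), forall n x, 0 <= w n x <= B n x,
    forall n x, w n.+1 x <= w n x & forall n, e / 2 <= phi (w n)].
Proof.
have [Mk MkP] := T_choice.
pose w := fix w n : Omega -> R :=
  if n is k.+1 then fun x => Num.min (w k x) (T n (Mk n) x) else T 0 (Mk 0%N).
have wL n : L (w n).
  by elim: n => [|n IH]; [exact: TL|apply: (lattice_min hL) => //; exact: TL].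
have w0 n x : 0 <= w n x by elim: n => [|n IH] /=; rewrite ?T0// le_min IH T0.
have gapL n (f : Omega -> R) : L f -> L (fun x => Num.max (f x - w n x) 0).
  by move=> Lf; apply: (lattice_max hL); [exact: (latticeB hL)|exact: (lattice_cst hL LT)].
(* Enlarging M to [maxn M (Mk k)] keeps the difference nonnegative, so that it can majorize positive
   parts. *)
have over k M : phi (fun x => T k (maxn M (Mk k)) x - T k (Mk k) x) <=
    e / 2 * 2^-1 ^+ k.+1.
  by rewrite (positiveB phiP)// lerBlDl.
have gap n M : phi (fun x => Num.max (T n M x - w n x) 0) <=
    e / 2 * (1 - 2^-1 ^+ n.+1).
  elim: n M => [|n IH] M.
    apply: (@le_trans _ _ (e / 2 * 2^-1 ^+ 1)); last by rewrite expr1; lra.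
    apply: le_trans (over 0%N M); apply: (positive_le hL phiP) => [||x].
    - exact: gapL.
    - exact: (latticeB hL).
    - by rewrite ge_max subr_ge0 lerB ?le_T ?leq_maxl ?leq_maxr.
  (* Where the new minimum is still w_n, T n.+1 M <= T n M gives the bound by the old gap; elsewhere
     the minimum is T n.+1 (Mk n.+1), and the new defect bounds the gap. *)
  have := lerD (IH M) (over n.+1 M).
  rewrite -(positiveD phiP); [|exact: gapL|exact: (latticeB hL)].
  move=> h; apply: (@le_trans _ _ (e / 2 * (1 - 2^-1 ^+ n.+1) + e / 2 * 2^-1 ^+ n.+2)).
    apply: le_trans h; apply: (positive_le hL phiP) => [||x].
    - exact: gapL.
    - by apply: (latticeD hL); [exact: gapL|exact: (latticeB hL)].
    have a1 := le_T x (leqnn n.+1) (leq_maxl M (Mk n.+1)).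
    have a2 := le_T x (leqnn n.+1) (leq_maxr M (Mk n.+1)).
    have a3 := le_T x (leqnSn n) (leqnn M).
    rewrite /= /Num.min; case: ltP => _; case: (leP (T n M x - w n x) 0) => ?;
      rewrite ge_max; apply/andP; split; lra.
  by rewrite [2^-1 ^+ n.+2]exprS; lra.
have wB n x : w n x <= B n x.
  by case: n => [|n] /=; rewrite ?TB// ge_min TB orbT.
exists w; split=> // [n x|n x|n].
- by rewrite w0 wB.
- by rewrite /= ge_min lexx.
have gw : phi (g n) <= phi (fun x => Num.max (T n n.+1 x - w n x) 0 + w n x).
  apply: (positive_le hL phiP) => // [|x].
    by apply: (latticeD hL) => //; exact: gapL.
  apply: (@le_trans _ _ (T n n.+1 x)); first by rewrite gT// leqnn ltnSn.
  by rewrite -lerBlDr le_max lexx.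
rewrite (positiveD phiP)// in gw; last exact: gapL.
have := gap n n.+1; have := eg n.
have : 0 <= e / 2 * 2^-1 ^+ n.+1 by rewrite mulr_ge0 ?exprn_ge0// ltW ?divr_gt0.
lra.
Qed.

Lemma dominated_contra : False.
Proof.
have [w [wL w0B w_decr ew]] := decreasing_minorant.
have w0 n x : 0 <= w n x by case/andP: (w0B n x).
have [B0 Bd BI] := Bdom.
have /choice[N NP] : forall n, exists N, forall k, (N <= k)%N ->
    I (B k) < 2^-1 ^+ n * 2^-1 ^+ n * 2^-1 ^+ n.
  by move=> n; apply: BI; rewrite !mulr_gt0// exprn_gt0// invr_gt0.
(* Summing the N i gives indices that are nondecreasing in n and at least N n. *)
pose s n := (\sum_(i < n.+1) N i)%N.
have w_mono n k x : (n <= k)%N -> w k x <= w n x.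
  elim: k => [|k IH]; first by rewrite leqn0 => /eqP ->.
  by rewrite leq_eqVlt => /orP[/eqP -> //|/IH]; exact: le_trans.
have phi1 : 0 <= phi (cst 1) by apply: (positive_ge0 phiP) => // x; exact: ler01.
(* Cutting at c lowers phi by at most c phi(1) <= e/4, which leaves e/4 of the bound e/2. *)
pose c := e / 4 / (phi (cst 1) + 1).
have c0 : 0 < c by rewrite !divr_gt0// ltr_wpDl.
have cphi : c * phi (cst 1) <= e / 4.
  by rewrite /c mulrAC ler_pdivrMr ?ltr_wpDl// ler_pM2l ?divr_gt0// lerDl.
apply: (@decreasing_contra (w \o s) _ _ _ _ c c0 (e / 4)) => //=.
- by move=> n x; apply: w_mono; rewrite /s [leqRHS]big_ord_recr leq_addr.
- move=> n; apply: le_trans (ltW (NP n (s n) _)); last first.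
    by rewrite /s big_ord_recr/= leq_addl.
  apply: (integral_le hA nuP) => [||x]; first exact: LI.
    by case: (B0 (s n)).
  by case/andP: (w0B (s n) x).
- by rewrite divr_gt0.
move=> n; have wc : phi (w (s n)) <= phi (fun x => excess c (w (s n)) x + c).
  apply: (positive_le hL phiP) => // [|x].
    by apply: (latticeD hL); [exact: (lattice_excess hL LT)|exact: (lattice_cst hL LT)].
  by rewrite -lerBlDr le_max lexx.
rewrite (positiveD phiP) in wc; [|exact: (lattice_excess hL LT)|exact: (lattice_cst hL LT)].
rewrite (positive_cst hL LT phiP) in wc.
have := ew (s n); lra.
Qed.

End decreasing_minorant.

Lemma order_continuous_of_monotone_extension (h : nat -> Omega -> R) :
  (forall n, L (h n)) -> order_cvg A nu h (cst 0) ->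
  phi (h n) @[n --> \oo] --> (0 : R).
Proof.
move=> hLn [_ [B Bdom hB]]; apply/cvg_seqP => e e0; apply: contrapT => /forallNP nh.
(* Since s n >= n, |h_(s n)| <= B_(s n) <= B_n: the offending terms stay below the same dominating
   sequence. *)
have /choice[s sP] : forall n, exists k, (n <= k)%N /\ e <= `|phi (h k)|.
  move=> n; have /existsNP[k /not_implyP[nk /negP]] := nh n.
  by rewrite subr0 -leNgt; exists k.
apply: (@dominated_contra (fun n x => `|h (s n) x|) B e) => //.
- by move=> n; exact: (lattice_norm hL LT).
- move=> n x; have := hB (s n) x; rewrite subr0 => /le_trans; apply.
  by apply: (dominating_mono _ Bdom); case: (sP n).
- move=> n; have [_ /le_trans] := sP n; apply.
  exact: (positive_norm hL LT phiP).
Qed.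

End monotone_extension.

(** * Consequences of order continuity at 0 *)

Section continuity.
Variables (R : realType) (Omega : Type) (A : set (set Omega)).
Variable nu : set Omega -> R.
Hypotheses (hA : set_algebra A) (nuP : ba_pos A nu).
Variables (L : set (Omega -> R)) (phi : (Omega -> R) -> R).
Hypotheses (hL : vector_sublattice L) (LT : L (cst 1)).
Hypothesis phiP : positive_linear L phi.
Implicit Types (f g : Omega -> R) (F G : nat -> Omega -> R).

Local Notation ov := (outer_variation A nu).
Local Notation I := (integral_fa A nu).
Local Notation L1 := (integrable_fa A nu).

(** Pointwise the positive part is at most B_n + C_n + (f - g)^+. The last term has integral 0, as f
    <= g off a null set, so it is dominating as a constant sequence. *)
Lemma order_cvg_pos F G f g : order_cvg A nu F f -> order_cvg A nu G g ->
  ov [set x | g x < f x] = 0 ->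
  order_cvg A nu (fun n x => Num.max (F n x - G n x) 0) (cst 0).
Proof.
move=> [FL [B Bdom FB]] [GL [C Cdom GC]] N0; split=> [n|].
  have := integrable_excess hA nuP 0 (integrableB hA nuP (FL n) (GL n)).
  by rewrite /excess; under eq_fun do rewrite subr0.
pose p x := Num.max (f x - g x) 0.
have [|pL p0] := @integral_null_off _ _ _ _ hA nuP p _ N0.
  by move=> x /negP; rewrite -leNgt => fg; rewrite /p max_r// subr_le0.
have pdom : dominating A nu (fun=> p).
  by apply: dominating_null => // x; rewrite /p le_max lexx orbT.
exists (fun n x => (B n x + C n x) + p x).
  by apply: (dominatingD hA nuP) pdom; exact: dominatingD.
move=> n x; rewrite subr0 ger0_norm; last by rewrite le_max lexx orbT.
have := FB n x; have := GC n x; rewrite !ler_norml => /andP[h1 h2] /andP[h3 h4].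
rewrite /p /Num.max; case: ltP => ?; case: ltP => ?; lra.
Qed.

Lemma outer_lt_null f g : (forall x, g x <= f x) -> ov [set x | f x < g x] = 0.
Proof.
move=> gf; rewrite (_ : [set x | _] = set0).
  apply/eqP; rewrite eq_le outer_ge0// andbT -(ba_pos0 hA nuP).
  by apply: (outer_le hA nuP) => //; exact: algebra0.
by rewrite predeqE => x; split=> //=; rewrite ltNge gf.
Qed.

Lemma positive_le_pos f g : L f -> L g ->
  phi f - phi g <= phi (fun x => Num.max (f x - g x) 0).
Proof.
move=> Lf Lg; have Lfg := latticeB hL Lf Lg.
rewrite -(positiveB phiP)//; apply: (positive_le hL phiP) => // [|x].
  by apply: (lattice_max hL) => //; exact: (lattice_cst hL LT).
by rewrite le_max lexx.
Qed.

Lemma cvg_le_of_diff (a b p : nat -> R) (la lb : R) :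
  a n @[n --> \oo] --> la -> b n @[n --> \oo] --> lb ->
  p n @[n --> \oo] --> (0 : R) -> (forall n, a n - b n <= p n) -> la <= lb.
Proof.
move=> acv bcv pcv abp; rewrite -subr_le0.
have abcv : (a n - b n) @[n --> \oo] --> la - lb by exact: cvgB.
rewrite -(cvg_lim _ abcv)// -(cvg_lim _ pcv)//.
apply: ler_lim; [by apply/cvg_ex; eexists; exact: abcv|
  by apply/cvg_ex; eexists; exact: pcv|by apply: nearW => n; exact: abp].
Qed.

Hypothesis phi_cont : forall F, (forall n, L (F n)) -> order_cvg A nu F (cst 0) ->
  phi (F n) @[n --> \oo] --> (0 : R).

(** If the values were not Cauchy, differences of terms with indices beyond n, dominated by 2 B_n,
    would converge orderly to 0 while phi stays at least e in absolute value on them. *)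
Lemma continuous_cvg F f : (forall n, L (F n)) -> order_cvg A nu F f ->
  exists l : R, phi (F n) @[n --> \oo] --> l.
Proof.
move=> LF [FI [B Bdom FB]]; apply: cauchy_seq_cvg => e e0.
apply: contrapT => /forallNP nF.
have /choice[s sP] : forall n, exists i : nat * nat,
    [/\ (n <= i.1)%N, (n <= i.2)%N & e <= `|phi (F i.1) - phi (F i.2)|].
  move=> n; have /existsNP[i /existsNP[j]] := nF n.
  move=> /not_implyP[ni /not_implyP[nj /negP]]; rewrite -leNgt => eij.
  by exists (i, j).
pose D n x := F (s n).1 x - F (s n).2 x.
have LD n : L (D n) by exact: (latticeB hL).
have /phi_cont-/(_ LD)/cvg_seqP/(_ e e0)[N /(_ N (leqnn N))] :
    order_cvg A nu D (cst 0).
  split=> [n|]; first exact: integrableB.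
  exists (fun n x => B n x + B n x); first exact: dominatingD.
  move=> n x; rewrite subr0; have [n1 n2 _] := sP n.
  rewrite /D -(subrKA (f x)); apply: le_trans (ler_normD _ _) _.
  rewrite [X in _ + X]distrC; apply: lerD; apply: le_trans (FB _ _) _;
    exact: (dominating_mono _ Bdom).
rewrite subr0 /D (positiveB phiP)// ltNge => /negP; apply.
by case: (sP N).
Qed.

Lemma continuous_le F G f g (a b : R) : (forall n, L (F n)) -> (forall n, L (G n)) ->
  order_cvg A nu F f -> order_cvg A nu G g -> (forall x, g x <= f x) ->
  phi (F n) @[n --> \oo] --> b -> phi (G n) @[n --> \oo] --> a -> a <= b.
Proof.
move=> LF LG Ff Gg gf Fb Ga.
have LP n : L (fun x => Num.max (G n x - F n x) 0).
  by apply: (lattice_max hL); [exact: (latticeB hL)|exact: (lattice_cst hL LT)].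
have := phi_cont LP (order_cvg_pos Gg Ff (outer_lt_null gf)).
by move=> /(cvg_le_of_diff Ga Fb); apply=> n; exact: positive_le_pos.
Qed.

Hypothesis LI : L `<=` L1.

Lemma continuous_min f : L f -> phi (fun x => Num.min (f x) n%:R) @[n --> \oo] --> phi f.
Proof.
move=> Lf; have LE n : L (excess n%:R f) by exact: (lattice_excess hL LT).
have := phi_cont LE (order_cvg_excess hA nuP (LI Lf)).
move=> /cvg_seqP pc; apply/cvg_seqP => e /pc[N pN]; exists N => n /pN.
have Lm : L (fun x => Num.min (f x) n%:R).
  by apply: (lattice_min hL) => //; exact: (lattice_cst hL LT).
rewrite subr0 distrC -(positiveB phiP)//.
by rewrite (_ : (fun x => f x - _) = excess n%:R f)//; apply/funext => x; exact: min_excess.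
Qed.

End continuity.

(** * Representing measures and the singular part *)

Section representing_measure.
Variables (R : realType) (Omega : Type) (L : set (Omega -> R)).
Hypotheses (hL : vector_sublattice L) (LT : L (cst 1)).
Implicit Types (f : Omega -> R) (phi psi : (Omega -> R) -> R).

Lemma lattice_trunc f n : L f -> L (fun x => Num.min (f x) n%:R).
Proof. by move=> Lf; apply: (lattice_min hL) => //; exact: (lattice_cst hL LT). Qed.

Lemma bounded_trunc f n : (forall x, 0 <= f x) ->
  bounded_funs (fun x => Num.min (f x) n%:R).
Proof.
move=> f0; exists n%:R => x; rewrite ger0_norm; first by rewrite ge_min lexx orbT.
by rewrite le_min f0 ler0n.
Qed.

Lemma lattice_pos_neg f : L f -> exists p q : Omega -> R,
  [/\ L p /\ L q, forall x, 0 <= p x, forall x, 0 <= q x & f = fun x => p x - q x].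
Proof.
move=> Lf; have L0 := lattice_cst hL LT 0.
exists (fun x => Num.max (f x) 0), (fun x => Num.max (-1 * f x) 0); split.
- by split; apply: (lattice_max hL) => //; exact: (latticeZ hL LT).
- by move=> x; rewrite le_max lexx orbT.
- by move=> x; rewrite le_max lexx orbT.
- by apply/funext => x; rewrite mulN1r; case: leP => ?; case: leP => ?; lra.
Qed.

Lemma positive_scale phi (k : R) : 0 <= k -> positive_linear L phi ->
  positive_linear L (fun f => k * phi f).
Proof.
move=> k0 [philin phi0]; split=> [a f g Lf Lg|f Lf f0].
  by rewrite philin//; ring.
by rewrite mulr_ge0// phi0.
Qed.

(** With the convention 0^-1 = 0 the case phi(1) = 0 is included: the normalized functional is then
    zero, and so are the integrals over L. *)
Lemma normalized_representation phi : positive_linear L phi ->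
  exists m : set Omega -> R, [/\ ba_pos setT m, L `<=` integrable_fa setT m,
    forall f, L f -> bounded_funs f ->
      integral_fa setT m f = (phi (cst 1))^-1 * phi f &
    forall f, L f -> (forall x, 0 <= f x) ->
      integral_fa setT m f <= (phi (cst 1))^-1 * phi f].
Proof.
move=> phiP; apply: (representation hL LT); apply: positive_scale => //.
by rewrite invr_ge0; apply: (positive_ge0 phiP) => // x; exact: ler01.
Qed.

(** When phi(1) = 0 the left side is 0, and phi vanishes on bounded functions because |phi f| <= M
    phi(1). *)
Lemma normalizedK phi f : positive_linear L phi -> L f -> bounded_funs f ->
  phi (cst 1) * ((phi (cst 1))^-1 * phi f) = phi f.
Proof.
move=> phiP Lf [M fM]; have [k0|k0] := eqVneq (phi (cst 1)) 0; last by rewrite mulVKf.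
rewrite k0 mul0r; apply/esym/eqP; rewrite -normr_le0.
apply: le_trans (positive_norm hL LT phiP Lf) _.
rewrite -(mulr0 M) -k0 -(positive_cst hL LT phiP).
apply: (positive_le hL phiP) => //; first exact: (lattice_norm hL LT).
exact: (lattice_cst hL LT).
Qed.

Lemma singular_part_exists phi : positive_linear L phi ->
  exists psi, singular_part L phi psi.
Proof.
move=> phiP; have [m [mP mL mB m_le]] := normalized_representation phiP.
have sT := @set_algebraT Omega.
have k0 : 0 <= phi (cst 1) by apply: (positive_ge0 phiP) => // x; exact: ler01.
exists (fun f => phi f - phi (cst 1) * integral_fa setT m f); split.
- split=> [a f g Lf Lg|f Lf f0].
    rewrite (positive_linearE phiP)// (integral_lin sT mP); try exact: mL.
    by ring.
  rewrite subr_ge0; apply: le_trans (ler_wpM2l k0 (m_le f Lf f0)) _.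
  have [->|kn0] := eqVneq (phi (cst 1)) 0; last by rewrite mulVKf.
  by rewrite mul0r; exact: (positive_ge0 phiP).
- have B1 : bounded_funs (cst (1 : R) : Omega -> R) by exact: bounded_funs_cst.
  by rewrite mB// normalizedK// subrr.
- by exists m; split=> // f Lf; rewrite addrC subrK.
Qed.

(** A positive psi with psi(1) = 0 kills the truncations, which lie between 0 and n. So phi of them
    is phi(1) times their integral and tends to phi(1) m(f). The sequence does not involve psi,
    whence uniqueness. *)
Lemma singular_part_limit phi psi f : positive_linear L phi ->
  singular_part L phi psi -> L f -> (forall x, 0 <= f x) ->
  phi (fun x => Num.min (f x) n%:R) @[n --> \oo] --> phi f - psi f.
Proof.
move=> phiP [psiP psi1 [m [mP mL mE]]] Lf f0.
have sT := @set_algebraT Omega.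
rewrite (mE f Lf) addrK.
have phi_min n : phi (fun x => Num.min (f x) n%:R) =
    phi (cst 1) * integral_fa setT m (fun x => Num.min (f x) n%:R).
  have Ln := lattice_trunc n Lf; rewrite (mE _ Ln).
  rewrite (_ : psi _ = 0) ?addr0//; apply/eqP; rewrite eq_le; apply/andP; split.
    rewrite -(mulr0 n%:R) -psi1 -(positive_cst hL LT psiP).
    apply: (positive_le hL psiP) => // [|x]; first exact: (lattice_cst hL LT).
    by rewrite ge_min lexx orbT.
  by apply: (positive_ge0 psiP) => // x; rewrite le_min f0 ler0n.
under eq_fun do rewrite phi_min.
apply: cvgMl_tmp; apply: (integral_min_cvg sT mP); first exact: mL.
by move=> n; apply: mL; exact: lattice_trunc.
Qed.

Lemma singular_part_unique phi psi psi' f : positive_linear L phi ->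
  singular_part L phi psi -> singular_part L phi psi' -> L f -> psi f = psi' f.
Proof.
move=> phiP sp sp' Lf.
have pos g : L g -> (forall x, 0 <= g x) -> psi g = psi' g.
  move=> Lg g0; have h := singular_part_limit phiP sp Lg g0.
  have h' := singular_part_limit phiP sp' Lg g0.
  have : phi g - psi g = phi g - psi' g by exact: cvg_unique h h'.
  by move=> /addrI /oppr_inj.
have [p [q [[Lp Lq] p0 q0 ->]]] := lattice_pos_neg Lf.
have [psiP _ _] := sp; have [psiP' _ _] := sp'.
by rewrite (positiveB psiP)// (positiveB psiP')// !pos.
Qed.

(** The formula for the integrals is recorded separately because representing phi says nothing about
    m when phi(1) = 0, while the limits of m(h_n) are needed in that case too. *)
Lemma continuous_representation phi (A : set (set Omega)) (nu : set Omega -> R) :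
  set_algebra A -> ba_pos A nu -> L `<=` integrable_fa A nu ->
  positive_linear L phi ->
  (forall F : nat -> Omega -> R, (forall n, L (F n)) -> order_cvg A nu F (cst 0) ->
    phi (F n) @[n --> \oo] --> (0 : R)) ->
  exists m : set Omega -> R, [/\ ba_pos setT m, representing L phi m &
    forall f, L f -> integral_fa setT m f = (phi (cst 1))^-1 * phi f].
Proof.
move=> hA nuP LI phiP phi_cont.
have [m [mP mL mB _]] := normalized_representation phiP; have sT := @set_algebraT Omega.
have phi_min f := continuous_min hA nuP hL LT phiP phi_cont LI (f := f).
have mE f : L f -> integral_fa setT m f = (phi (cst 1))^-1 * phi f.
  have pos g : L g -> (forall x, 0 <= g x) ->
      integral_fa setT m g = (phi (cst 1))^-1 * phi g.
    move=> Lg g0; have Lt n := lattice_trunc n Lg.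
    have h := integral_min_cvg sT mP (mL _ Lg) (fun n => mL _ (Lt n)).
    have E n : integral_fa setT m (fun x => Num.min (g x) n%:R) =
        (phi (cst 1))^-1 * phi (fun x => Num.min (g x) n%:R).
      by rewrite mB//; exact: bounded_trunc.
    rewrite (funext E) in h.
    have h' : (phi (cst 1))^-1 * phi (fun x => Num.min (g x) n%:R) @[n --> \oo] -->
        (phi (cst 1))^-1 * phi g by apply: cvgMl_tmp; exact: phi_min.
    exact: cvg_unique h h'.
  move=> Lf; have [p [q [[Lp Lq] p0 q0 ->]]] := lattice_pos_neg Lf.
  rewrite (integralB sT mP); [|exact: mL|exact: mL].
  by rewrite !pos// -mulrBr (positiveB phiP).
exists m; split=> //; split=> //; first by case: mP.
move=> f Lf; rewrite mE//.
(* If phi(1) = 0, then phi vanishes on the bounded functions of L and hence, by continuity along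
   truncations, on all of L. *)
have [k0|k0] := eqVneq (phi (cst 1)) 0; last by rewrite mulVKf.
rewrite k0 mul0r.
have pos g : L g -> (forall x, 0 <= g x) -> phi g = 0.
  move=> Lg g0; have h := phi_min _ Lg.
  have E n : phi (fun x => Num.min (g x) n%:R) = 0.
    rewrite -(normalizedK phiP (lattice_trunc n Lg) (bounded_trunc n g0)).
    by rewrite k0 mul0r.
  rewrite (funext E) in h.
  have h0 : (fun=> 0 : R) n @[n --> \oo] --> (0 : R) by exact: cvg_cst.
  exact: cvg_unique h h0.
have [p [q [[Lp Lq] p0 q0 ->]]] := lattice_pos_neg Lf.
by rewrite (positiveB phiP)// !pos// subrr.
Qed.

End representing_measure.

(** * Passage from the signed charge to its variation *)

Section bridge.
Variables (R : realType) (Omega : Type) (A : set (set Omega)).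
Variable mu : set Omega -> R.
Hypotheses (hA : set_algebra A) (muP : ba A mu).

Lemma cvg_orderlyE (F : nat -> Omega -> R) (f : Omega -> R) :
  cvg_orderly A mu F f <-> order_cvg A (variation_fa A mu) F f.
Proof.
have nuP := variation_ba_pos hA muP.
have normE (g : Omega -> R) : (forall x, 0 <= g x) ->
    norm_fa A mu g = integral_fa A (variation_fa A mu) g.
  move=> g0; rewrite /norm_fa; congr integral_fa.
  by apply/funext => x; rewrite ger0_norm.
rewrite /cvg_orderly (integrable_variationE hA muP).
split=> -[FL].
  move=> [B [B0 Bd Bs FB]]; split=> //; exists B => //; split=> // e e0.
  rewrite (_ : (fun n => _) = fun n => integral_fa A (variation_fa A mu) (B n))
    in Bs; last by apply/funext => n; rewrite normE//; case: (B0 n).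
  have /cvg_seqP/(_ e e0)[N BN] := Bs; exists N => n /BN.
  by rewrite subr0 => /(le_lt_trans (ler_norm _)).
move=> [B [B0 Bd Bs] FB]; split=> //; exists B; split=> //.
rewrite (_ : (fun n => _) = fun n => integral_fa A (variation_fa A mu) (B n)).
  by apply/cvg_seq0P => // n; have [BL Bp] := B0 n; exact: integral_ge0.
by apply/funext => n; rewrite normE//; case: (B0 n).
Qed.

End bridge.

Theorem theorem1 (R : realType) (Omega : Type) :
  (forall (A : set (set Omega)) (mu : set Omega -> R)
      (L : set (Omega -> R)) (phi : (Omega -> R) -> R),
    set_algebra A -> ba A mu ->
    vector_sublattice L -> L `<=` integrable_fa A mu -> L (cst 1) ->
    positive_linear L phi ->
    [<-> (* (i) *)
         exists phis : (Omega -> R) -> R,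
           (forall f, L f -> phis f = phi f) /\
           (forall f g, order_limits A mu L f -> order_limits A mu L g ->
              ae_le A mu f g -> phis f <= phis g);
         (* (ii) *)
         forall h_ : nat -> Omega -> R,
           (forall n, L (h_ n)) -> cvg_orderly A mu h_ (cst 0) ->
           phi (h_ n) @[n --> \oo] --> (0 : R);
         (* (iii) *)
         forall (f_ g_ : nat -> Omega -> R) (f g : Omega -> R),
           (forall n, L (f_ n)) -> (forall n, L (g_ n)) ->
           cvg_orderly A mu f_ f -> cvg_orderly A mu g_ g ->
           (forall x, g x <= f x) ->
           exists a b : R,
             [/\ phi (g_ n) @[n --> \oo] --> a,
                 phi (f_ n) @[n --> \oo] --> b & a <= b];
         (* (iv) *)
         exists m : set Omega -> R,
           [/\ ba_pos setT m, representing L phi m &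
               exists ms : (Omega -> R) -> R,
                 forall (h_ : nat -> Omega -> R) (h : Omega -> R),
                   (forall n, L (h_ n)) -> cvg_orderly A mu h_ h ->
                   integral_fa setT m (h_ n) @[n --> \oo] --> ms h] ]) /\
  (forall (L : set (Omega -> R)) (phi : (Omega -> R) -> R),
    vector_sublattice L -> L (cst 1) -> positive_linear L phi ->
    exists2 phip : (Omega -> R) -> R,
      singular_part L phi phip &
      forall psi : (Omega -> R) -> R, singular_part L phi psi ->
        forall f, L f -> psi f = phip f).
Proof.
split; last first.
  move=> L phi hL LT phiP.
  have [psi psiS] := singular_part_exists hL LT phiP.
  exists psi => // psi' psiS' f Lf.
  exact: (singular_part_unique hL LT phiP psiS' psiS Lf).
move=> A mu L phi hA muP hL LI LT phiP.
have nuP := variation_ba_pos hA muP; have oE := cvg_orderlyE hA muP.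
have ovE := outer_variationE hA muP.
rewrite (integrable_variationE hA muP) in LI.
set nu := variation_fa A mu in nuP oE ovE LI.
tfae.
- move=> [phis [phis_ext phis_le]] h Lh /oE.
  apply: (order_continuous_of_monotone_extension hA nuP hL LT phiP LI phis_ext) => //.
  move=> f g [F LF /oE Ff] [G LG /oE Gg] fg; apply: phis_le.
  + by exists F.
  + by exists G.
  + by rewrite /ae_le ovE.
- move=> cont F G f g LF LG /oE Ff /oE Gg gf.
  have phi_cont H : (forall n, L (H n)) -> order_cvg A nu H (cst 0) ->
      phi (H n) @[n --> \oo] --> (0 : R) by move=> LH /oE; exact: cont.
  have [b Fb] := continuous_cvg hA nuP hL phiP phi_cont LF Ff.
  have [a Ga] := continuous_cvg hA nuP hL phiP phi_cont LG Gg.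
  exists a, b; split=> //.
  exact: (continuous_le hA nuP hL LT phiP phi_cont LF LG Ff Gg gf Fb Ga).
- move=> lims.
  (* Taking g = f in (iii), with the two sequences in both roles, gives both inequalities between
     the limits. *)
  have lim_unique F G f (a b : R) : (forall n, L (F n)) -> (forall n, L (G n)) ->
      cvg_orderly A mu F f -> cvg_orderly A mu G f ->
      phi (F n) @[n --> \oo] --> a -> phi (G n) @[n --> \oo] --> b -> a = b.
    move=> LF LG Ff Gf Fa Gb.
    have [a1 [b1 [Ga1 Fb1 ab1]]] := lims F G f f LF LG Ff Gf (fun x => lexx _).
    have [a2 [b2 [Fa2 Gb2 ab2]]] := lims G F f f LG LF Gf Ff (fun x => lexx _).
    have -> : a = b1 by exact: cvg_unique Fa Fb1.
    have -> : b = a1 by exact: cvg_unique Gb Ga1.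
    apply/eqP; rewrite eq_le ab1 andbT.
    have -> : b1 = a2 by exact: cvg_unique Fb1 Fa2.
    by have -> : a1 = b2 by exact: cvg_unique Ga1 Gb2.
  have L0 : L (cst 0) := lattice_cst hL LT 0.
  (* Comparison with the constant sequence 0 identifies the limit supplied by (iii) as 0. *)
  have zero_cvg : cvg_orderly A mu (fun=> cst 0) (cst 0).
    by apply/oE; exact/(order_cvg_cst hA nuP)/LI.
  have phi_cont H : (forall n, L (H n)) -> order_cvg A nu H (cst 0) ->
      phi (H n) @[n --> \oo] --> (0 : R).
    move=> LH /oE H0.
    have [_ [b [_ Hb _]]] := lims H H _ _ LH LH H0 H0 (fun x => lexx _).
    have z0 : (fun=> phi (cst 0)) n @[n --> \oo] --> (0 : R).
      rewrite (_ : phi (cst 0) = 0); first exact: cvg_cst.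
      exact: (positive0 hL LT phiP).
    by rewrite -(lim_unique _ _ _ _ _ LH (fun=> L0) H0 zero_cvg Hb z0).
  have [m [mP mrep mE]] := continuous_representation hL LT hA nuP LI phiP phi_cont.
  exists m; split=> //.
  (* Uniqueness of limits makes the choice of F immaterial; 0 is the default outside the order
     limits. *)
  pose lim_of h := xget 0 [set l : R | exists F : nat -> Omega -> R,
    [/\ forall n, L (F n), cvg_orderly A mu F h & phi (F n) @[n --> \oo] --> l]].
  exists (fun h => (phi (cst 1))^-1 * lim_of h) => F h LF Fh.
  have [_ [l [_ Fl _]]] := lims F F h h LF LF Fh Fh (fun x => lexx _).
  have -> : lim_of h = l.
    rewrite /lim_of; case: xgetP => [l' _ [G [LG Gh Gl']]|/(_ l)[]]; last by exists F.
    exact: (lim_unique _ _ _ _ _ LG LF Gh Fh Gl' Fl).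
  under eq_fun do rewrite mE//.
  exact: cvgMl_tmp.
- move=> [m [mP [_ mL mE] [ms msP]]].
  have phi_cvg F f : (forall n, L (F n)) -> cvg_orderly A mu F f ->
      phi (F n) @[n --> \oo] --> phi (cst 1) * ms f.
    move=> LF Ff; under eq_fun do rewrite mE//.
    by apply: cvgMl_tmp; exact: msP.
  have ext f : L f -> phi (cst 1) * ms f = phi f.
    move=> Lf; have fcvg : cvg_orderly A mu (fun=> f) f.
      by apply/oE; exact/(order_cvg_cst hA nuP)/LI.
    have h := phi_cvg _ _ (fun=> Lf) fcvg.
    have h' : (fun=> phi f) n @[n --> \oo] --> phi f by exact: cvg_cst.
    exact: cvg_unique h h'.
  exists (fun f => phi (cst 1) * ms f); split=> // f g [F LF Ff] [G LG Gg].
  rewrite /ae_le ovE => fg.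
  (* F_n - G_n lies below its positive part, which converges orderly to 0 because f <= g off a null
     set; phi of that part tends to phi(0) = 0. *)
  have LP n : L (fun x => Num.max (F n x - G n x) 0).
    by apply: (lattice_max hL); [exact: (latticeB hL)|exact: (lattice_cst hL LT)].
  have /oE/(phi_cvg _ _ LP) : order_cvg A nu (fun n x => Num.max (F n x - G n x) 0) (cst 0).
    by apply: (order_cvg_pos hA nuP) fg; exact/oE.
  rewrite ext; last exact: (lattice_cst hL LT).
  rewrite (positive0 hL LT phiP) => Pcvg.
  apply: (cvg_le_of_diff (phi_cvg _ _ LF Ff) (phi_cvg _ _ LG Gg) Pcvg) => n.
  exact: (positive_le_pos hL LT phiP).
Qed.
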